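(* Let $\{g_n\}_{n\in\mathbb{N}}$ be an (infinite) orthonormal sequence (or a Riesz sequence) in $L^2(\mathbb{R}^+)$. Then at least one of the following two statements holds: $$\sup_{n\in\mathbb{N}}|g_n(x)|\notin L^2(\mathbb{R}^+)\qquad\text{or}\qquad\sup_{n\in\mathbb{N}}|\mathcal{M}g_n(\omega)|\notin L^2(\mathbb{R}),$$ where the suprema are taken pointwise (almost everywhere) and regarded as functions of $x\in\mathbb{R}^+$ and $\omega\in\mathbb{R}$ respectively.
   Context: Functions are complex-valued. $\mathbb{R}^+=(0,+\infty)$ and $L^2(\mathbb{R}^+)=L^2(\mathbb{R}^+,r^{-1}dr)$ is the space of measurable functions on $\mathbb{R}^+$ that are square integrable with respect to the Haar measure $r^{-1}dr$. The Mellin transform is $$\mathcal{M}f(\omega)=\int_0^{+\infty}f(r)r^{-2\pi i\omega}\,\frac{dr}{r},\qquad\omega\in\mathbb{R},$$ understood on $L^2(\mathbb{R}^+)$ in the Plancherel sense, i.e. $\mathcal{M}f$ is the ($L^2$, unitary) Fourier transform, with kernel $e^{-2\pi i\omega x}$, of the function $x\mapsto f(e^x)\in L^2(\mathbb{R})$. A sequence $\{u_n\}_{n\in\mathbb{N}}$ in a Hilbert space $H$ (here $H=L^2(\mathbb{R}^+)$) is a Riesz sequence if there is an invertible bounded linear operator $U:H\to H$ with bounded inverse such that $\{U(u_n)\}_{n\in\mathbb{N}}$ is an orthonormal sequence in $H$. *)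

(* Defs.v *)
From HB Require Import structures.
From mathcomp Require Import all_boot all_order all_algebra.
From mathcomp Require Import all_classical all_reals all_analysis.
From mathcomp Require Import measurable_realfun complex.

Set Implicit Arguments.
Unset Strict Implicit.
Unset Printing Implicit Defensive.
Import Order.TTheory GRing.Theory Num.Theory.
Import numFieldNormedType.Exports.

Local Open Scope classical_set_scope.
Local Open Scope ring_scope.

Section L2.
Context d (T : measurableType d) (R : realType).
Variables (mu : {measure set T -> \bar R}) (D : set T).

Definition modulus (f : T -> R[i]) (x : T) : \bar R :=
  (Normc.normc (f x))%:E.

Definition cmeasurable (f : T -> R[i]) : Prop :=
  measurable_fun D (fun x => complex.Re (f x)) /\
  measurable_fun D (fun x => complex.Im (f x)).

Definition cintegrable (f : T -> R[i]) : Prop :=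
  mu.-integrable D (fun x => (complex.Re (f x))%:E) /\
  mu.-integrable D (fun x => (complex.Im (f x))%:E).

Definition cintegral (f : T -> R[i]) : R[i] :=
  ((\int[mu]_(x in D) complex.Re (f x)) +i*
   (\int[mu]_(x in D) complex.Im (f x)))%C.

Definition L2norm (h : T -> \bar R) : \bar R := Lnorm mu 2%:E (h \_ D).

(* Square-integrability of an extended-real function (a supremum of moduli may
   be infinite at some points). *)
Definition eL2 (h : T -> \bar R) : Prop :=
  measurable_fun D h /\ (L2norm h < +oo)%E.

(* Elements of the Hilbert space L^2(D, mu) are represented by functions; the
   equality of that space is [f = g %[ae mu in D]]. *)
Definition L2 (f : T -> R[i]) : Prop :=
  cmeasurable f /\ (L2norm (modulus f) < +oo)%E.

Definition inner (f g : T -> R[i]) : R[i] :=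
  cintegral (fun x => f x * (g x)^*%C).

Definition L2_cvg (u : nat -> T -> R[i]) (f : T -> R[i]) : Prop :=
  L2norm (modulus (fun x => u n x - f x)) @[n --> \oo] --> 0%E.

Definition orthonormal_sequence (u : nat -> T -> R[i]) : Prop :=
  (forall n, L2 (u n)) /\ (forall n m, inner (u n) (u m) = (n == m)%:R).

(* The first two fields say that [U] induces a map on a.e.-classes. *)
Record bounded_operator (U : (T -> R[i]) -> T -> R[i]) : Prop := {
  op_L2 : forall f, L2 f -> L2 (U f) ;
  op_ae : forall f g, L2 f -> L2 g ->
    f = g %[ae mu in D] -> U f = U g %[ae mu in D] ;
  op_linear : forall (a : R[i]) f g, L2 f -> L2 g ->
    U (fun x => a * f x + g x) = (fun x => a * U f x + U g x) %[ae mu in D] ;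
  op_bounded : exists K : R, forall f, L2 f ->
    (L2norm (modulus (U f)) <= K%:E * L2norm (modulus f))%E }.

Definition riesz_sequence (u : nat -> T -> R[i]) : Prop :=
  (forall n, L2 (u n)) /\
  exists U V : (T -> R[i]) -> T -> R[i],
    [/\ bounded_operator U, bounded_operator V,
        forall f, L2 f -> V (U f) = f %[ae mu in D],
        forall f, L2 f -> U (V f) = f %[ae mu in D] &
        orthonormal_sequence (fun n => U (u n))].

End L2.

Section haar.
Context {R : realType}.

Definition Rplus : set R := `]0, +oo[.

(* The Haar measure r^-1 dr of the multiplicative group of positive reals, as a
   measure on the whole real line. *)
Definition haar (A : set (measurableTypeR R)) : \bar R :=
  \int[lebesgue_measure]_(r in A `&` Rplus) (r^-1)%:E.

Let haar0 : haar set0 = 0%E.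
Proof. by rewrite /haar set0I integral_set0. Qed.

Let haar_ge0 A : (0 <= haar A)%E.
Proof.
apply: integral_ge0 => r [_]; rewrite /Rplus /= in_itv /= andbT => r0.
by rewrite lee_fin invr_ge0 ltW.
Qed.

Let haar_sigma_additive : semi_sigma_additive haar.
Proof.
move=> A mA tA mUA.
have mP : measurable Rplus by exact: measurable_itv.
have P_gt0 r : Rplus r -> 0 < r by rewrite /Rplus /= in_itv /= andbT.
rewrite /haar setI_bigcupl ge0_integral_bigcup//=.
- by apply: is_cvg_ereal_nneg_natsum_cond => n _ _; exact: haar_ge0.
- by move=> n; apply: measurableI.
- rewrite -setI_bigcupl; apply/measurable_EFinP.
  apply: (@eq_measurable_fun _ _ _ _ _ (fun r => r `^ (-1))).
    by move=> r; rewrite inE => -[_ /P_gt0 r0]; rewrite powR_inv1// ltW.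
  by apply: measurable_funTS; exact: measurable_powR.
- by move=> r [n _ [_ /P_gt0 r0]]; rewrite lee_fin invr_ge0 ltW.
- exact: trivIset_setIr.
Qed.

HB.instance Definition _ := isMeasure.Build _ _ _
  haar haar0 haar_ge0 haar_sigma_additive.

End haar.

Section mellin.
Context {R : realType}.
Local Notation leb := (@lebesgue_measure R).

Definition fourier (f : R -> R[i]) (w : R) : R[i] :=
  cintegral leb setT
    (fun x => f x * (cos (2 * pi * w * x) -i* sin (2 * pi * w * x))%C).

(* [h] represents the Plancherel transform of [f]: the unique continuous
   extension to L^2 of the Fourier integral, which is defined on the dense
   subspace of functions both integrable and square-integrable. *)
Definition is_plancherel (f h : R -> R[i]) : Prop :=
  [/\ L2 leb setT f, L2 leb setT h &
    exists u : nat -> R -> R[i],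
      [/\ forall n, cintegrable leb setT (u n) /\ L2 leb setT (u n),
          L2_cvg leb setT u f &
          L2_cvg leb setT (fun n => fourier (u n)) h]].

Definition is_mellin (f h : R -> R[i]) : Prop :=
  is_plancherel (fun x => f (expR x)) h.

End mellin.

(* Main.v *)
Require Import Defs.
From HB Require Import structures.
From mathcomp Require Import all_boot all_order all_algebra.
From mathcomp Require Import all_classical all_reals all_analysis.
From mathcomp Require Import measurable_realfun complex.
From mathcomp Require Import ring lra.
Import Order.TTheory GRing.Theory Num.Theory.
Import numFieldNormedType.Exports.
Local Open Scope classical_set_scope.
Local Open Scope ring_scope.

(** Pulling everything back by the exponential, which carries Lebesgue measure
to the Haar measure, gives functions [f_n(x) = g_n(e^x)] on the line whose
Plancherel transforms are the [h_n = Mg_n].  Suppose that both suprema were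
square integrable, say [|f_n| <= F] and [|h_n| <= G] with [F] and [G] in L^2.
Then the [f_n] are essentially confined to one bounded window in space and
one in frequency, and only finitely many dimensions' worth of functions live
there, which an orthonormal or Riesz sequence cannot tolerate.

Concretely, such a sequence satisfies
[||sum c_n f_n||^2 <= K sum c_n^2] and [||f_n||^2 >= 1/K]
([orthonormal_bessel], [riesz_bessel]).  By duality the first estimate is
Bessel's inequality, so the [f_n] tend weakly to zero ([weak_null]).  Choose
[L] such that [F^2] has little mass outside [[-L, L]] and let [v_n] be the
restriction of [f_n] to that window.  It is integrable, so its transform at a
point [w] is the pairing of [f_n] with a truncated character: it is bounded
and tends to zero for each [w], hence tends to zero in L^2 of every bounded
frequency window ([fourier_cutoff_null]).  By Plancherel the transform of
[v_n] is uniformly close to [h_n], and [G] controls [h_n] outside a window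
[[-M, M]]; therefore [||h_n||] is eventually as small as desired.  This
contradicts [||f_n||^2 <= 4 ||h_n||^2] and the lower bound on [||f_n||]
([not_both_dominated]).

Plancherel's identity is proved on integrable square-integrable functions
([plancherel]); the transform of a general [f] is reached through the
approximations that define it, at the cost of a constant.  For a real function [p] with autocorrelation [r(z) = int p(x) p(x+z) dx], the power
spectrum at [w] is [int r(z) cos(2 pi w z) dz] ([power_spectrum]).  Integrating
it against [e^(-a|w|)] turns the cosine into the Poisson kernel of width [a]
([weighted_power]).  As [a] tends to zero the left-hand side increases to the
energy of the transform, and the right-hand side tends to [r(0)], the energy
of [p], because translations are continuous in L^2 ([shift_energy_cvg0]). *)

Set Implicit Arguments.
Unset Strict Implicit.
Unset Printing Implicit Defensive.

(** * Translation and reflection of Lebesgue integrals *)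

Section translation.
Context {R : realType}.
Local Notation leb := (@lebesgue_measure R).

Let measurable_addr (z : R) : measurable_fun [set: measurableTypeR R]
  (fun x : measurableTypeR R => (x + z : measurableTypeR R)).
Proof. exact: measurable_funD. Qed.

Lemma lebesgue_measure_translate (z : R) (A : set R) : measurable A ->
  pushforward leb (fun x : measurableTypeR R => (x + z : measurableTypeR R)) A = leb A.
Proof.
move=> mA; apply/esym/lebesgue_measure_unique => //= _ [[a b]] _ <-.
rewrite /pushforward.
rewrite (_ : _ @^-1` _ = `]a - z, b - z]%classic); last first.
  by apply/seteqP; split => x /=; rewrite !in_itv/= ltrBlDr lerBrDr.
rewrite !lebesgue_measure_itv/= !lte_fin ltrBlDr subrK; case: ifP => // _.
by rewrite -!EFinB; congr EFin; ring.
Qed.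

Lemma ge0_integral_translate (z : R) (f : R -> \bar R) :
  measurable_fun setT f -> (forall x, 0 <= f x)%E ->
  (\int[leb]_x f (x + z)%R = \int[leb]_x f x)%E.
Proof.
move=> mf f0; rewrite -[LHS](ge0_integral_pushforward (measurable_addr z) leb measurableT mf)//.
apply: eq_measure_integral => A mA _; exact: lebesgue_measure_translate.
Qed.

Lemma ge0_integral_reflect (f : R -> \bar R) :
  measurable_fun setT f -> (forall x, 0 <= f x)%E ->
  (\int[leb]_x f (- x)%R = \int[leb]_x f x)%E.
Proof.
move=> mf f0.
have mN : measurable_fun [set: measurableTypeR R]
    (fun x : measurableTypeR R => (- x : measurableTypeR R)).
  exact: measurable_funN.
rewrite -[LHS](ge0_integral_pushforward mN leb measurableT mf)//.
apply: eq_measure_integral => A mA _; exact: lebesgue_measureN.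
Qed.

Lemma integral_translate (z : R) (f : R -> \bar R) : measurable_fun setT f ->
  (\int[leb]_x f (x + z)%R = \int[leb]_x f x)%E.
Proof.
move=> mf; rewrite integralE [RHS]integralE; congr (_ - _)%E.
  have <- := ge0_integral_translate z (measurable_funepos mf) (funepos_ge0 f).
  by apply: eq_integral => x _; rewrite !funeposE.
have <- := ge0_integral_translate z (measurable_funeneg mf) (funeneg_ge0 f).
by apply: eq_integral => x _; rewrite !funenegE.
Qed.

Lemma integral_reflect (f : R -> \bar R) : measurable_fun setT f ->
  (\int[leb]_x f (- x)%R = \int[leb]_x f x)%E.
Proof.
move=> mf; rewrite integralE [RHS]integralE; congr (_ - _)%E.
  have <- := ge0_integral_reflect (measurable_funepos mf) (funepos_ge0 f).
  by apply: eq_integral => x _; rewrite !funeposE.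
have <- := ge0_integral_reflect (measurable_funeneg mf) (funeneg_ge0 f).
by apply: eq_integral => x _; rewrite !funenegE.
Qed.

End translation.

(** * Real square-integrable functions *)

Section square_integrable.
Context d (T : measurableType d) (R : realType).
Variables (mu : {measure set T -> \bar R}) (D : set T) (mD : measurable D).
Implicit Types p q f g : T -> R.

Definition real_integrable f := mu.-integrable D (EFin \o f).
Definition square_integrable p :=
  measurable_fun D p /\ real_integrable (fun x => p x ^+ 2).
Definition real_energy p : R := \int[mu]_(x in D) (p x ^+ 2).

Local Notation intg := real_integrable.
Local Notation sqi := square_integrable.
Local Notation energy := real_energy.

Lemma intg_measurable f : intg f -> measurable_fun D f.
Proof. by move=> /integrableP[/measurable_EFinP]. Qed.

Lemma le_intg f g : measurable_fun D f -> intg g ->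
  (forall x, D x -> `|f x| <= g x) -> intg f.
Proof.
move=> mf ig fg; apply: (@le_integrable _ _ _ _ _ mD _ (EFin \o g)) => //.
  exact/measurable_EFinP.
by move=> x Dx /=; rewrite lee_fin (le_trans (fg x Dx))// ler_norm.
Qed.

Lemma eq_intg f g : (forall x, D x -> f x = g x) -> intg f -> intg g.
Proof.
move=> fg; apply: (eq_integrable mD) => x /set_mem Dx /=.
by rewrite fg.
Qed.

Lemma EFin_Rint f : intg f ->
  ((\int[mu]_(x in D) f x)%R%:E = \int[mu]_(x in D) (f x)%:E)%E.
Proof. by move=> fi; rewrite fineK//; exact: integrable_fin_num. Qed.

Lemma intgD f g : intg f -> intg g -> intg (fun x => f x + g x).
Proof. by move=> fi gi; exact: (integrableD mD fi gi). Qed.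

Lemma intgB f g : intg f -> intg g -> intg (fun x => f x - g x).
Proof. by move=> fi gi; exact: (integrableB mD fi gi). Qed.

Lemma intgZ c f : intg f -> intg (fun x => c * f x).
Proof. by move=> fi; exact: (integrableZl mD c fi). Qed.

Lemma intg_norm f : intg f -> intg (fun x => `|f x|).
Proof. by move=> fi; exact: integrable_norm. Qed.

Lemma ge0_intg f : measurable_fun D f -> (forall x, D x -> 0 <= f x) ->
  (\int[mu]_(x in D) (f x)%:E < +oo)%E -> intg f.
Proof.
move=> mf f0 foo; apply/integrableP; split; first exact/measurable_EFinP.
rewrite (le_lt_trans _ foo)// le_eqVlt; apply/predU1l/eq_integral => x /set_mem Dx.
by rewrite /= ger0_norm// f0.
Qed.

Lemma sqi_mul p q : sqi p -> sqi q -> intg (fun x => p x * q x).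
Proof.
move=> [mp ip] [mq iq]; apply: (le_intg (measurable_funM mp mq) (intgD ip iq)).
move=> x _; rewrite normrM -(real_normK (num_real (p x))) -(real_normK (num_real (q x))).
by have := sqr_ge0 (`|p x| - `|q x|); nra.
Qed.

Lemma sqiD p q : sqi p -> sqi q -> sqi (fun x => p x + q x).
Proof.
move=> sp sq; split; first exact: measurable_funD sp.1 sq.1.
apply: (@eq_intg (fun x => (p x ^+2 + 2 * (p x * q x)) + q x ^+2)).
  by move=> x _; ring.
exact: intgD (intgD sp.2 (intgZ 2 (sqi_mul sp sq))) sq.2.
Qed.

Lemma sqiZ c p : sqi p -> sqi (fun x => c * p x).
Proof.
move=> sp; split; first exact: measurable_funM sp.1.
by apply: eq_intg (intgZ (c ^+ 2) sp.2) => x _; rewrite exprMn.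
Qed.

Lemma sqiB p q : sqi p -> sqi q -> sqi (fun x => p x - q x).
Proof.
move=> sp sq; have := sqiD sp (sqiZ (-1) sq).
by congr sqi; apply/funext => x; rewrite mulN1r.
Qed.

Lemma energy_ge0 p : 0 <= energy p.
Proof. by apply: Rintegral_ge0 => x _; exact: sqr_ge0. Qed.

Lemma energyD p q : sqi p -> sqi q -> energy (fun x => p x + q x) =
  energy p + 2 * (\int[mu]_(x in D) (p x * q x)) + energy q.
Proof.
move=> sp sq; have ipq := sqi_mul sp sq.
rewrite /energy -RintegralZl// -!RintegralD//.
- by apply: eq_Rintegral => x _; ring.
- exact: intgD sp.2 (intgZ 2 ipq).
- exact: sq.2.
- exact: sp.2.
- exact: intgZ.
Qed.

Lemma energyZ c p : sqi p -> energy (fun x => c * p x) = c ^+ 2 * energy p.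
Proof.
move=> sp; rewrite /energy -RintegralZl//; last exact: sp.2.
by apply: eq_Rintegral => x _; rewrite exprMn.
Qed.

Lemma le_energy p q : sqi p -> sqi q -> (forall x, D x -> `|p x| <= `|q x|) ->
  energy p <= energy q.
Proof.
move=> sp sq pq; apply: le_Rintegral => //; [exact: sp.2|exact: sq.2|].
move=> x Dx; rewrite -(real_normK (num_real (p x))) -(real_normK (num_real (q x))).
by rewrite lerXn2r ?nnegrE// pq.
Qed.

(** This crude form of the triangle inequality avoids square roots.  The lost
factor is harmless: it is applied a bounded number of times, to errors that
can be made arbitrarily small. *)
Lemma energyD_le p q : sqi p -> sqi q ->
  energy (fun x => p x + q x) <= 2 * energy p + 2 * energy q.
Proof.
move=> sp sq.
rewrite /energy -!RintegralZl//; [|exact: sq.2|exact: sp.2].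
rewrite -RintegralD//; [|apply: intgZ; exact: sp.2|apply: intgZ; exact: sq.2].
apply: le_Rintegral => //; first exact: (sqiD sp sq).2.
  by apply: intgD; apply: intgZ; [exact: sp.2|exact: sq.2].
by move=> x _; have := sqr_ge0 (p x - q x); nra.
Qed.

Lemma energyB_le p q : sqi p -> sqi q ->
  energy (fun x => p x - q x) <= 2 * energy p + 2 * energy q.
Proof.
move=> sp sq; have := energyD_le sp (sqiZ (-1) sq).
rewrite energyZ// sqrrN expr1n mul1r; congr (_ <= _).
by apply: eq_Rintegral => x _; rewrite mulN1r.
Qed.

Lemma EFin_energy p : sqi p ->
  ((energy p)%:E = \int[mu]_(x in D) (p x ^+ 2)%:E)%E.
Proof. by move=> sp; rewrite EFin_Rint//; exact: sp.2. Qed.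

Lemma Rint_dominated (f_ : nat -> T -> R) f g :
  (forall n, measurable_fun D (f_ n)) -> measurable_fun D f -> intg g ->
  (forall n x, D x -> `|f_ n x| <= g x) ->
  {ae mu, forall x, D x -> f_ n x @[n --> \oo] --> f x} ->
  \int[mu]_(x in D) f_ n x @[n --> \oo] --> \int[mu]_(x in D) f x.
Proof.
move=> mf_ mf ig fg cf.
have [|||||fi _ cvg_f] := @dominated_convergence _ _ _ mu D mD
  (fun n x => (f_ n x)%:E) (EFin \o f) (EFin \o g).
- by move=> n; exact/measurable_EFinP.
- exact/measurable_EFinP.
- apply: filterS cf => x cfx Dx; apply: cvg_EFin; last exact: cfx.
  exact: nearW.
- exact: ig.
- by apply: aeW => x n Dx; exact: fg.
apply: fine_cvg; rewrite EFin_Rint//.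
Qed.

End square_integrable.

(** * Continuity of translations in L^2 *)

Section translation_continuity.
Context {R : realType}.
Local Notation leb := (@lebesgue_measure R).
Local Notation intg := (real_integrable leb setT).
Local Notation sqi := (square_integrable leb setT).
Local Notation energy := (real_energy leb setT).
Implicit Types p q r g : R -> R.

Lemma measurable_translate d (S : measurableType d) (z : R) (f : R -> S) :
  measurable_fun setT f -> measurable_fun setT (fun x : R => f (x + z)).
Proof. by move=> mf; apply: (measurableT_comp mf); exact: measurable_funD. Qed.

Lemma intg_translate z (f : R -> R) : intg f -> intg (fun x : R => f (x + z)).
Proof.
move=> /integrableP[mf foo]; apply/integrableP; split.
  exact: (measurable_translate z mf).
by rewrite (ge0_integral_translate z (f := fun x => `|(f x)%:E|%E))//; exact: measurableT_comp.
Qed.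

Lemma sqi_translate z p : sqi p -> sqi (fun x : R => p (x + z)).
Proof.
move=> sp; split; first exact: (measurable_translate z sp.1).
exact: (intg_translate z sp.2).
Qed.

Lemma Rint_translate z (f : R -> R) : measurable_fun setT f ->
  \int[leb]_x f (x + z) = \int[leb]_x f x.
Proof.
move=> mf; congr fine; apply: (integral_translate z (f := EFin \o f)).
exact/measurable_EFinP.
Qed.

Lemma energy_translate z p : sqi p -> energy (fun x : R => p (x + z)) = energy p.
Proof.
move=> sp; rewrite /energy (Rint_translate z (f := fun x => p x ^+ 2))//.
exact: measurable_funX sp.1.
Qed.

Definition shift_energy p z := energy (fun x : R => p (x + z) - p x).

Lemma shift_energy_ge0 p z : 0 <= shift_energy p z.
Proof. exact: energy_ge0. Qed.

Lemma shift_energy_le p z : sqi p -> shift_energy p z <= 4 * energy p.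
Proof.
move=> sp; have := energyB_le measurableT (sqi_translate z sp) sp.
by rewrite energy_translate// => /le_trans; apply; lra.
Qed.

(** The error [p - r] enters once as such and once translated, whence the 8.
The bound is uniform in [z], so that it suffices to know that translation is
continuous on a dense class. *)
Lemma shift_energy_approx p r z : sqi p -> sqi r ->
  shift_energy p z <= 8 * energy (fun x => p x - r x) + 2 * shift_energy r z.
Proof.
move=> sp sr; have spr := sqiB measurableT sp sr.
have := energyD_le measurableT (sqiB measurableT (sqi_translate z spr) spr)
  (sqiB measurableT (sqi_translate z sr) sr).
have := shift_energy_le z spr; rewrite /shift_energy => H1 H2.
apply: (@le_trans _ _ (energy (fun x : R =>
    p (x + z) - r (x + z) - (p x - r x) + (r (x + z) - r x)))).
  by rewrite le_eqVlt; apply/predU1l/eq_Rintegral => x _; congr (_ ^+ 2); ring.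
by apply: (le_trans H2); lra.
Qed.

Lemma measurable_cut (M : R) (f : R -> R) : measurable_fun setT f ->
  measurable_fun setT (fun x : R => if `|x| <= M then f x else 0).
Proof.
move=> mf; apply: measurable_fun_ifT => //.
by apply: measurable_fun_ler => //; exact: measurableT_comp.
Qed.

Lemma intg_cut_cst (M c : R) : intg (fun x : R => if `|x| <= M then c else 0).
Proof.
have := integrable_indic_itv (- M) M true false.
move=> /(integrableZl measurableT c); apply: eq_integrable => //= x _.
by rewrite indicE mem_setE/= in_itv/= -ler_norml; case: ifP; rewrite ?mulr1 ?mulr0 ?mule1 ?mule0.
Qed.

Lemma sqi_cut (M C : R) g : measurable_fun setT g -> (forall x, `|x| <= M -> `|g x| <= C) ->
  sqi (fun x : R => if `|x| <= M then g x else 0).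
Proof.
move=> mg gC; split; first exact: measurable_cut.
apply: (le_intg measurableT _ (intg_cut_cst M (C ^+ 2))).
  apply: measurable_funX; exact: measurable_cut.
move=> x _; case: ifPn => [xM|_]; last by rewrite expr0n normr0.
by rewrite normrX lerXn2r ?nnegrE ?gC// (le_trans _ (gC x xM)).
Qed.

(** Dominated convergence, with [p ^+ 2] as the dominating function. *)
Lemma sqi_truncate p (e : R) : sqi p -> 0 < e -> exists M : R, 0 < M /\
  energy (fun x : R => p x - (if `|x| <= M then (if `|p x| <= M then p x else 0) else 0)) <= e.
Proof.
move=> sp e0.
pose h n x := if `|x| <= n.+1%:R then (if `|p x| <= n.+1%:R then p x else 0) else 0.
have mh n : measurable_fun setT (h n).
  apply: measurable_cut; apply: measurable_fun_ifT => //; last exact: sp.1.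
  by apply: measurable_fun_ler => //; apply: measurableT_comp => //; exact: sp.1.
have hcvg : \int[leb]_x ((p x - h n x) ^+ 2) @[n --> \oo] --> \int[leb]_x (cst 0 x : R).
  apply: (@Rint_dominated _ _ _ leb setT measurableT
    (fun n x => (p x - h n x) ^+ 2) (cst 0) (fun x => p x ^+ 2)).
  - by move=> n; apply: measurable_funX; exact: measurable_funB sp.1 (mh n).
  - exact: measurable_cst.
  - exact: sp.2.
  - move=> n x _; rewrite ger0_norm ?sqr_ge0// /h.
    by do 2 (case: ifP => _; last by rewrite subr0); rewrite subrr expr0n sqr_ge0.
  - apply: aeW => x _; apply: cvg_near_cst; near=> n.
    rewrite /h; have nx : `|x| <= n.+1%:R.
      rewrite -natr1 ler_wpDr//; near: n; exact: nbhs_infty_ger.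
    have npx : `|p x| <= n.+1%:R.
      rewrite -natr1 ler_wpDr//; near: n; exact: nbhs_infty_ger.
    by rewrite nx npx subrr expr0n.
rewrite Rintegral_cst// mul0r in hcvg.
move/cvgrPdist_le : hcvg => /(_ e e0)[N _ /(_ N (leqnn N))].
rewrite sub0r normrN => HN; exists N.+1%:R; split => //.
exact: le_trans (ler_norm _) HN.
Unshelve. all: end_near. Qed.

Lemma clip_dist (M a b : R) : `|a| <= M ->
  `|a - Num.max (- M) (Num.min M b)| <= `|a - b|.
Proof.
rewrite ler_norml => /andP[aM Ma].
have [Mb|bM] := ltP M b.
  rewrite max_r; last by lra.
  by rewrite !ler0_norm; lra.
have [Mb|bM'] := leP (- M) b; first by [].
by rewrite !ger0_norm; lra.
Qed.

(** After truncation, density of continuous functions in L^1 is enough: if [q]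
and [G] are bounded by [M], then [(q - G)^2 <= 2 M |q - G|].  Clipping the
approximant to [[-M, M]] provides this bound without moving it away from
[q]. *)
Lemma sqi_approx p (e : R) : sqi p -> 0 < e -> exists M g,
  [/\ 0 < M, continuous g, forall x, `|g x| <= M &
      energy (fun x : R => p x - (if `|x| <= M then g x else 0)) <= e].
Proof.
move=> sp e0; have [|M [M0 pM]] := @sqi_truncate p (e / 4) sp; first by rewrite divr_gt0.
pose q x := if `|x| <= M then (if `|p x| <= M then p x else 0) else 0.
have mq0 : measurable_fun setT (fun x => if `|p x| <= M then p x else 0 : R).
  apply: measurable_fun_ifT => //; last exact: sp.1.
  by apply: measurable_fun_ler => //; apply: measurableT_comp => //; exact: sp.1.
have mq : measurable_fun setT q by exact: measurable_cut.
have qM x : `|q x| <= M.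
  by rewrite /q; case: ifP => _; first case: ifP => // _; rewrite normr0 ltW.
have sq : sqi q.
  apply: (sqi_cut (C := M)) => // x xM.
  by case: ifP => // _; rewrite normr0 ltW.
pose E : set R := `[- M, M]%classic.
have mE : measurable E by exact: measurable_itv.
have Eoo : (leb E < +oo)%E.
  by rewrite lebesgue_measure_itv/=; case: ifP => _; rewrite ?ltry// -EFinB ltry.
have iq : leb.-integrable E (EFin \o q).
  apply: measurable_bounded_integrable => //; first exact: measurable_funTS.
  by exists M; split; [exact: num_real|move=> y My x _; exact: le_trans (qM x) (ltW My)].
have [g_ [cg ig qg]] := approximation_continuous_integrable mE Eoo iq.
have c0 : 0 < e / (8 * M) by rewrite divr_gt0// mulr_gt0.
have /fine_cvgP[gfin /cvgrPdist_le /(_ _ c0)] := qg.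
move=> gc; have [n [gnfin gnc]] : exists n,
    ((\int[leb]_(z in E) `|(q z - g_ n z)%:E|)%E \is a fin_num) /\
    `|0 - fine (\int[leb]_(z in E) `|(q z - g_ n z)%:E|)%E| <= e / (8 * M).
  near \oo => n; exists n; split; near: n => //; exact: gc.
pose G x := Num.max (- M) (Num.min M (g_ n x)).
have GM x : `|G x| <= M.
  rewrite ler_norml /G le_max lexx/= ge_max ge_min lexx/= andbT.
  by rewrite lerNl (le_trans _ (ltW M0))// oppr_le0 ltW.
have cG : continuous G.
  move=> x; apply: (@continuous_max _ _ (cst (- M)) (fun x => Num.min M (g_ n x))).
    exact: cst_continuous.
  by apply: (@continuous_min _ _ (cst M) (g_ n)); [exact: cst_continuous|exact: cg].
exists M, G; split => //.
have sG : sqi (fun x => if `|x| <= M then G x else 0).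
  by apply: (sqi_cut (C := M)) => //; exact: continuous_measurable_fun.
have qG : energy (fun x => q x - (if `|x| <= M then G x else 0)) <= e / 4.
  rewrite -lee_fin EFin_energy//; last exact: sqiB.
  apply: (@le_trans _ _ (\int[leb]_x (((fun x => (2 * M)%:E * `|(q x - g_ n x)%:E|)%E) \_ E) x)%E).
    have mg : measurable_fun setT (g_ n) by exact: continuous_measurable_fun.
    apply: ge0_le_integral => //.
    - by move=> x _; rewrite lee_fin sqr_ge0.
    - by apply/measurable_EFinP; apply: measurable_funX; apply: measurable_funB => //; exact: sG.1.
    - apply/(measurable_restrictT _ _).1 => //; apply: measurable_funTS.
      apply: measurable_funeM; apply: measurableT_comp => //.
      by apply/measurable_EFinP; exact: measurable_funB.
    - move=> x _; rewrite patchE; case: (boolP (x \in E)) => xE; last first.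
        move: xE => /negP; rewrite inE /E /= in_itv/= -ler_norml /q => /negP /negbTE ->.
        by rewrite subrr expr0n.
      have xM : `|x| <= M by move: xE; rewrite inE /E /= in_itv/= -ler_norml.
      rewrite xM /= lee_fin -(real_normK (num_real (q x - G x))) expr2.
      apply: ler_pM => //.
        by rewrite (le_trans (ler_normB _ _))// mulr_natl mulr2n lerD.
      exact: clip_dist.
  rewrite -integral_mkcond ge0_integralZl//; last 2 first.
  - apply: measurable_funTS; apply: measurableT_comp => //.
    by apply/measurable_EFinP; apply: measurable_funB => //; exact: continuous_measurable_fun.
  - by rewrite lee_fin mulr_ge0// ltW.
  rewrite -(fineK gnfin) -EFinM lee_fin.
  move: gnc; rewrite sub0r normrN => /(le_trans (ler_norm _)).
  rewrite -(ler_pM2l (x := 2 * M)) ?mulr_gt0// => /le_trans; apply.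
  by rewrite le_eqVlt; apply/predU1l; field; rewrite gt_eqF.
have := energyD_le measurableT (sqiB measurableT sp sq) (sqiB measurableT sq sG).
move=> H; apply: le_trans (le_trans H _).
  by rewrite le_eqVlt; apply/predU1l/eq_Rintegral => x _; rewrite addrA subrK.
lra.
Unshelve. all: end_near. Qed.

Lemma ae_neq_norm (M : R) : {ae leb, forall x : R, `|x| != M}.
Proof.
exists ([set M] `|` [set - M]); split.
- by apply: measurableU; exact: measurable_set1.
- apply/eqP; rewrite eq_le measure_ge0 andbT.
  apply: (@le_trans _ _ (leb [set M] + leb [set (- M)%R])%E).
    by apply: measureU2; exact: measurable_set1.
  by rewrite !lebesgue_measure_set1 adde0.
- move=> x /= /negP; rewrite negbK => /eqP <-.
  by have [x0|x0] := leP 0 x; [left; rewrite ger0_norm|right; rewrite ltr0_norm// opprK].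
Qed.

(** A continuous function cut to [[-M, M]] is continuous except at the two end
points, so dominated convergence applies.  Shifts by at most 1 keep all the
differences inside [[-M - 1, M + 1]]. *)
Lemma shift_energy_cut_cvg (M : R) g (z_ : nat -> R) : continuous g ->
  (forall x, `|g x| <= M) ->
  (forall n, `|z_ n| <= 1) -> z_ n @[n --> \oo] --> 0 ->
  shift_energy (fun x : R => if `|x| <= M then g x else 0) (z_ n) @[n --> \oo] --> 0.
Proof.
move=> cg gM z1 zcvg; set r := fun x : R => if _ then _ else _.
have sr : sqi r by apply: (sqi_cut (C := M)) => //; exact: continuous_measurable_fun.
have mr := sr.1.
have rM x : `|r x| <= M.
  rewrite /r; case: ifP => // _; rewrite normr0.
  by rewrite (le_trans _ (gM 0)).
have -> : 0 = \int[leb]_x (cst 0 x : R) by rewrite Rintegral_cst// mul0r.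
apply: (@Rint_dominated _ _ _ leb setT measurableT (fun n x => (r (x + z_ n) - r x) ^+ 2) (cst 0)
  (fun x => if `|x| <= M + 1 then (2 * M) ^+ 2 else 0)).
- move=> n; apply: measurable_funX; apply: measurable_funB => //.
  exact: measurable_translate.
- exact: measurable_cst.
- exact: intg_cut_cst.
- move=> n x _; rewrite ger0_norm ?sqr_ge0//; case: ifPn => [_|].
    rewrite -(real_normK (num_real (r _ - r _))) lerXn2r ?nnegrE//.
      by rewrite mulr_ge0// (le_trans _ (gM 0)).
    by rewrite (le_trans (ler_normB _ _))// mulr_natl mulr2n lerD.
  rewrite -ltNge => xM.
  have H : (`|x| <= M) = false by apply/negbTE; rewrite -ltNge; lra.
  have H' : (`|x + z_ n| <= M) = false.
    apply/negbTE; rewrite -ltNge; have := z1 n.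
    by have := ler_normB (x + z_ n) (z_ n); rewrite addrK; lra.
  by rewrite /r H H' subrr expr0n.
- have := ae_neq_norm M; apply: filter_app.
    exact: (ae_filter_ringOfSetsType leb).
  apply: aeW => x xM _.
  suff rx : r (x + z_ n) @[n --> \oo] --> r x.
    have -> : 0 = (r x - r x) ^+ 2 :> R by rewrite subrr expr0n.
    rewrite expr2; under eq_cvg do rewrite expr2.
    by apply: cvgM; apply: cvgB => //; exact: cvg_cst.
  have xz : x + z_ n @[n --> \oo] --> x.
    rewrite -[X in _ --> X]addr0; apply: cvgD => //; exact: cvg_cst.
  have nxz : `|x + z_ n| @[n --> \oo] --> `|x| by apply: cvg_norm.
  move: xM; rewrite neq_lt => /orP[xM|xM].
    have rxE : r x = g x by rewrite /r ltW.
    rewrite rxE; apply: cvg_trans (continuous_cvg _ (cg x) xz).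
    apply: near_eq_cvg; near=> n; rewrite /r ifT//; apply: ltW.
    by near: n; exact: (cvgr_lt _ nxz).
  have rxE : r x = 0 by rewrite /r leNgt xM.
  rewrite rxE; apply: cvg_near_cst; near=> n; rewrite /r ifF//.
  apply/negbTE; rewrite -ltNge.
  by near: n; exact: (cvgr_gt _ nxz).
Unshelve. all: end_near. Qed.

(** Translation is continuous in L^2. *)
Lemma shift_energy_cvg0 p (e : R) : sqi p -> 0 < e ->
  exists d : R, 0 < d /\ forall z, `|z| < d -> shift_energy p z <= e.
Proof.
move=> sp e0; have [|M [g [M0 cg gM pg]]] := @sqi_approx p (e / 16) sp; first by rewrite divr_gt0.
apply: contrapT => /forallNP H.
have {}H n : exists z : R, `|z| < n.+1%:R^-1 /\ e < shift_energy p z.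
  have /not_andP[|/existsNP[z /not_implyP[zn /negP]]] := H n.+1%:R^-1.
    by rewrite invr_gt0.
  by rewrite -ltNge => ez; exists z.
have [z_ zP] := choice H.
have zcvg : z_ n @[n --> \oo] --> 0.
  apply/cvgr0Pnorm_lt => d d0; near=> n.
  apply: (lt_trans (zP n).1); near: n; exact: near_infty_natSinv_lt (PosNum d0).
have z1 n : `|z_ n| <= 1.
  by rewrite (le_trans (ltW (zP n).1))// invf_le1// ler1n.
have /cvgr0Pnorm_lt := shift_energy_cut_cvg cg gM z1 zcvg.
have e4 : 0 < e / 4 by rewrite divr_gt0.
move=> /(_ _ e4) [N _ /(_ N (leqnn N))]; rewrite ger0_norm ?shift_energy_ge0// => vN.
have sr : sqi (fun x => if `|x| <= M then g x else 0).
  by apply: (sqi_cut (C := M)) => //; exact: continuous_measurable_fun.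
have := shift_energy_approx (z_ N) sp sr.
have := (zP N).2; lra.
Unshelve. all: end_near. Qed.

End translation_continuity.

(** * The Abel weight and the Poisson kernel *)

Section abel_poisson.
Context {R : realType}.
Local Notation leb := (@lebesgue_measure R).
Local Notation intg := (real_integrable leb setT).

Definition abel_weight (a w : R) : R := expR (- (a * `|w|)).
(** The Fourier transform of [abel_weight a], which has total mass 1. *)
Definition poisson_kernel (a z : R) : R := 2 * a / (a ^+ 2 + (2 * pi * z) ^+ 2).

Lemma abel_weight_ge0 a w : 0 <= abel_weight a w. Proof. exact: expR_ge0. Qed.

Lemma continuous_abel_weight a : continuous (abel_weight a).
Proof.
move=> w; apply: (@continuous_comp _ _ _ (fun r : R => - (a * `|r|)) expR);
  last exact: continuous_expR.
apply: cvgN => /=; apply: cvgM; first exact: cvg_cst.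
exact: norm_continuous.
Qed.

Lemma continuous_cosM (b : R) : continuous (fun w : R => cos (b * w)).
Proof.
move=> w; apply: (@continuous_comp _ _ _ (fun r : R => b * r) cos); last exact: continuous_cos.
by apply: cvgM; [exact: cvg_cst|exact: cvg_id].
Qed.

Lemma continuous_sinM (b : R) : continuous (fun w : R => sin (b * w)).
Proof.
move=> w; apply: (@continuous_comp _ _ _ (fun r : R => b * r) sin); last exact: continuous_sin.
by apply: cvgM; [exact: cvg_cst|exact: cvg_id].
Qed.

Lemma is_derive_lin (b x : R) : is_derive x 1 (fun w : R => b * w) b.
Proof.
have := @is_deriveZ _ _ _ id b x 1 1 (is_derive_id _ _).
by rewrite [_ *: _]mulr1.
Qed.

(** A primitive of [e^(-a w) (1 + cos (b w))] that vanishes at infinity. *)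
Let prim (a b w : R) : R := expR (- a * w) *
  ((b * sin (b * w) - a * cos (b * w)) / (a ^+ 2 + b ^+ 2) - a^-1).

Let is_derive_prim (a b w : R) : 0 < a ->
  is_derive w 1 (prim a b) (expR (- a * w) * (1 + cos (b * w))).
Proof.
move=> a0.
have d1 : is_derive w 1 (fun w : R => expR (- a * w)) (- a * expR (- a * w)).
  have := @is_derive1_comp R expR (fun w => - a * w) w _ _ (is_derive_expR _) (is_derive_lin _ _).
  by rewrite mulrC.
have d2 : is_derive w 1 (fun w : R => sin (b * w)) (b * cos (b * w)).
  have := @is_derive1_comp R sin (fun w => b * w) w _ _ (is_derive_sin _) (is_derive_lin _ _).
  by rewrite mulrC.
have d3 : is_derive w 1 (fun w : R => cos (b * w)) (- b * sin (b * w)).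
  have := @is_derive1_comp R cos (fun w => b * w) w _ _ (is_derive_cos _) (is_derive_lin _ _).
  by rewrite mulrC mulrN mulNr.
pose E w := expR (- a * w); pose S w := sin (b * w); pose C w := cos (b * w).
have -> : prim a b = E * ((a ^+ 2 + b ^+ 2)^-1 *: (b *: S - a *: C) - cst a^-1).
  by apply/funext => x; rewrite /prim/= !fctE /E /S /C /GRing.scale/=; ring.
have ab0 : a ^+ 2 + b ^+ 2 != 0 by rewrite gt_eqF// ltr_pwDl ?exprn_gt0// sqr_ge0.
apply: is_derive_eq.
rewrite /E /S /C !fctE /GRing.scale/=; field.
by rewrite ab0 gt_eqF.
Qed.

Let prim_cvg0 (a b : R) : 0 < a -> prim a b x @[x --> +oo] --> 0.
Proof.
move=> a0; apply/norm_cvg0P.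
pose K : R := `|(a ^+ 2 + b ^+ 2)^-1| * (`|b| + a) + a^-1.
apply: (@squeeze_cvgr _ _ _ _ (cst 0) (fun x => expR (- (a * x)) * K)).
- near=> x; rewrite normr_ge0/= /prim normrM ger0_norm ?expR_ge0// mulNr.
  rewrite ler_wpM2l ?expR_ge0// (le_trans (ler_normB _ _))//.
  rewrite lerD// ?[`|a^-1|]ger0_norm ?invr_ge0 ?(ltW a0)//.
  rewrite normrM mulrC ler_wpM2l// (le_trans (ler_normB _ _))//.
  rewrite !normrM lerD//.
    by rewrite ler_piMr// ler_norml sin_le1 sin_geN1.
  by rewrite (ger0_norm (ltW a0)) ler_piMr ?(ltW a0)// ler_norml cos_le1 cos_geN1.
- exact: cvg_cst.
- rewrite -(mul0r K); apply: cvgM; last exact: cvg_cst.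
  apply: (@cvg_comp _ _ _ (fun x : R => a * x) (fun x => expR (- x)) _ +oo%R);
    last exact: cvgr_expR.
  by apply: gt0_cvgMry => //; exact: cvg_id.
Unshelve. all: end_near. Qed.

Let half_abel_weight (a b : R) : 0 < a ->
  (\int[leb]_(x in `[0%R, +oo[) (expR (- a * x) * (1 + cos (b * x)))%:E =
   (a / (a ^+ 2 + b ^+ 2) + a^-1)%:E)%E.
Proof.
move=> a0.
have cE : continuous (fun x : R => expR (- a * x) * (1 + cos (b * x))).
  move=> x; apply: cvgM.
    apply: (@continuous_comp _ _ _ (fun r : R => - a * r) expR); last exact: continuous_expR.
    by apply: cvgM; [exact: cvg_cst|exact: cvg_id].
  by apply: cvgD; [exact: cvg_cst|exact: continuous_cosM].
have dP x := @is_derive_prim a b x a0.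
rewrite (@ge0_continuous_FTC2y _ _ (prim a b) 0 0).
- by rewrite -EFinB sub0r /prim !mulr0 expR0 sin0 cos0; congr EFin; ring.
- by move=> x _; rewrite mulr_ge0 ?expR_ge0//; have := cos_geN1 (b * x); lra.
- exact: continuous_subspaceT.
- exact: prim_cvg0.
- by move=> x _; exact: ex_derive.
- apply: cvg_at_right_filter.
  have d0 : derivable (prim a b) 0 1 by case: (dP 0).
  exact: (differentiable_continuous ((derivable1_diffP _ _).1 d0)).
- by move=> x _; rewrite derive1E derive_val.
Qed.

(** Adding 1 to the cosine makes the integrand nonnegative, so that the
fundamental theorem of calculus applies on the half-line; the extra term is
the case [b = 0] and is subtracted afterwards. *)
Lemma integral_abel_weightDcos (a b : R) : 0 < a ->
  (\int[leb]_w (abel_weight a w * (1 + cos (b * w)))%:E =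
   (2 * a / (a ^+ 2 + b ^+ 2) + 2 / a)%:E)%E.
Proof.
move=> a0; rewrite ge0_symfun_integralT.
- rewrite -set_itvcy (_ : (2 * a / _ + _) = 2 * (a / (a ^+ 2 + b ^+ 2) + a^-1)); last by ring.
  rewrite EFinM -(half_abel_weight b a0); congr (_ * _)%E; apply: eq_integral => x /set_mem.
  by rewrite /= in_itv/= andbT => x0; rewrite /abel_weight ger0_norm// mulNr.
- by move=> x; rewrite mulr_ge0 ?abel_weight_ge0//; have := cos_geN1 (b * x); lra.
- move=> x; apply: cvgM; first exact: continuous_abel_weight.
  by apply: cvgD; [exact: cvg_cst|exact: continuous_cosM].
- by move=> x /=; rewrite /abel_weight normrN mulrN cosN.
Qed.

Lemma measurable_abel_weight a : measurable_fun setT (abel_weight a).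
Proof. by apply: continuous_measurable_fun; exact: continuous_abel_weight. Qed.

Lemma measurable_cosM b : measurable_fun setT (fun w : R => cos (b * w)).
Proof. by apply: continuous_measurable_fun; exact: continuous_cosM. Qed.

Lemma measurable_sinM b : measurable_fun setT (fun w : R => sin (b * w)).
Proof. by apply: continuous_measurable_fun; exact: continuous_sinM. Qed.

Let intg_abel_weightDcos (a b : R) : 0 < a -> intg (fun w => abel_weight a w * (1 + cos (b * w))).
Proof.
move=> a0; apply: ge0_intg => //.
- apply: measurable_funM; first exact: measurable_abel_weight.
  by apply: measurable_funD => //; exact: measurable_cosM.
- by move=> x _; rewrite mulr_ge0 ?abel_weight_ge0//; have := cos_geN1 (b * x); lra.
- by rewrite integral_abel_weightDcos// ltry.
Qed.

Lemma intg_abel_weight (a : R) : 0 < a -> intg (abel_weight a).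
Proof.
move=> a0; apply: (le_intg measurableT _ (intg_abel_weightDcos 0 a0)).
  exact: measurable_abel_weight.
move=> x _; rewrite mul0r cos0 ger0_norm ?abel_weight_ge0//.
by have := abel_weight_ge0 a x; lra.
Qed.

Lemma integral_abel_weight (a : R) : 0 < a -> \int[leb]_w abel_weight a w = 2 / a.
Proof.
move=> a0; have := integral_abel_weightDcos 0 a0.
rewrite -EFin_Rint//; last exact: intg_abel_weightDcos.
move=> H0; have {H0} := EFin_inj H0.
have -> : \int[leb]_x (abel_weight a x * (1 + cos (0 * x))) = 2 * \int[leb]_w abel_weight a w.
  rewrite -RintegralZl//; last exact: intg_abel_weight.
  by apply: eq_Rintegral => x _; rewrite mul0r cos0 mulrC.
have -> : 2 * a / (a ^+ 2 + 0 ^+ 2) + 2 / a = 2 * (2 / a).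
  by rewrite expr0n/= addr0; field; rewrite gt_eqF.
by apply: mulfI.
Qed.

Lemma intg_abel_weight_cos (a b : R) : 0 < a ->
  intg (fun w => abel_weight a w * cos (b * w)).
Proof.
move=> a0; apply: (le_intg measurableT _ (intg_abel_weight a0)).
  by apply: measurable_funM; [exact: measurable_abel_weight|exact: measurable_cosM].
by move=> x _; rewrite normrM (ger0_norm (abel_weight_ge0 _ _)) ler_piMr ?abel_weight_ge0// cos_max.
Qed.

Lemma integral_abel_weight_cos (a z : R) : 0 < a ->
  \int[leb]_w (abel_weight a w * cos (2 * pi * z * w)) = poisson_kernel a z.
Proof.
move=> a0; have := integral_abel_weightDcos (2 * pi * z) a0.
rewrite -EFin_Rint//; last exact: intg_abel_weightDcos.
move=> H0; have {H0} := EFin_inj H0.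
under eq_Rintegral => w _ do rewrite mulrDr mulr1.
rewrite RintegralD//; [|exact: intg_abel_weight|exact: intg_abel_weight_cos].
by rewrite integral_abel_weight// addrC => /addIr.
Qed.

Let poisson_den_gt0 (a z : R) : 0 < a -> 0 < a ^+ 2 + (2 * pi * z) ^+ 2.
Proof. by move=> a0; rewrite ltr_pwDl ?exprn_gt0// sqr_ge0. Qed.

Lemma poisson_ge0 (a z : R) : 0 < a -> 0 <= poisson_kernel a z.
Proof.
move=> a0; apply: divr_ge0; last by rewrite ltW// poisson_den_gt0.
by rewrite mulr_ge0// ltW.
Qed.

Lemma continuous_poisson (a : R) : 0 < a -> continuous (poisson_kernel a).
Proof.
move=> a0 z; apply: cvgM; first exact: cvg_cst.
apply: cvgV; first by rewrite gt_eqF// poisson_den_gt0.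
apply: cvgD; first exact: cvg_cst.
apply: (@continuous_comp _ _ _ (fun z => 2 * pi * z) (fun y => y ^+ 2));
  last exact: exprn_continuous.
by apply: cvgM; [exact: cvg_cst|exact: cvg_id].
Qed.

Lemma measurable_poisson (a : R) : 0 < a -> measurable_fun setT (poisson_kernel a).
Proof. by move=> a0; apply: continuous_measurable_fun; exact: continuous_poisson. Qed.

Let is_derive_atan_scaled (a p z : R) : 0 < a -> 0 < p ->
  is_derive z 1 (fun z => p^-1 * atan (2 * p / a * z)) (2 * a / (a ^+ 2 + (2 * p * z) ^+ 2)).
Proof.
move=> a0 p0.
have d1 := @is_derive1_comp R atan (fun w => 2 * p / a * w) z _ _
  (is_derive1_atan _) (is_derive_lin _ _).
have := @is_deriveZ _ _ _ _ p^-1 z 1 _ d1.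
congr is_derive; rewrite /GRing.scale/=; field.
by rewrite (gt_eqF p0) (gt_eqF a0) andbT gt_eqF// ltr_pwDl ?exprn_gt0// sqr_ge0.
Qed.

Let integral_poisson_ereal (a : R) : 0 < a -> (\int[leb]_z (poisson_kernel a z)%:E = 1)%E.
Proof.
move=> a0; rewrite ge0_symfun_integralT.
- rewrite -set_itvcy (@ge0_continuous_FTC2y _ _ (fun z => pi^-1 * atan (2 * pi / a * z)) 0 2^-1).
  + rewrite mulr0 atan0 mulr0 sube0 -EFinM mulfV//.
  + by move=> x _; exact: poisson_ge0.
  + by apply: continuous_subspaceT; exact: continuous_poisson.
  + have -> : 2^-1 = pi^-1 * (pi / 2) :> R by rewrite mulrA mulVf ?mul1r// gt_eqF// pi_gt0.
    apply: cvgM; first exact: cvg_cst.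
    apply: (@cvg_comp _ _ _ (fun x : R => 2 * pi / a * x) atan _ +oo%R); last exact: cvgy_atan.
    by apply: gt0_cvgMry; [rewrite divr_gt0// mulr_gt0// pi_gt0|exact: cvg_id].
  + by move=> x _; case: (is_derive_atan_scaled x a0 (pi_gt0 R)).
  + apply: cvg_at_right_filter; apply: cvgM; first exact: cvg_cst.
    apply: (@continuous_comp _ _ _ (fun z => 2 * pi / a * z) atan); last exact: continuous_atan.
    by apply: cvgM; [exact: cvg_cst|exact: cvg_id].
  + by move=> x _; have dx := is_derive_atan_scaled x a0 (pi_gt0 R); rewrite derive1E derive_val.
- by move=> x; exact: poisson_ge0.
- exact: continuous_poisson.
- by move=> x /=; rewrite /poisson_kernel mulrN sqrrN.
Qed.

Lemma intg_poisson (a : R) : 0 < a -> intg (poisson_kernel a).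
Proof.
move=> a0; apply: ge0_intg => //; first exact: measurable_poisson.
  by move=> x _; exact: poisson_ge0.
by rewrite integral_poisson_ereal// ltry.
Qed.

Lemma integral_poisson (a : R) : 0 < a -> \int[leb]_z poisson_kernel a z = 1.
Proof. by move=> a0; rewrite /Rintegral integral_poisson_ereal. Qed.

(** Away from the origin the kernel of width [a] is [a] times a constant
multiple of the kernel of width 1, so its mass there vanishes with [a]. *)
Lemma poisson_tail (a d z : R) : 0 < a -> a <= 1 -> 0 < d -> d <= `|z| ->
  poisson_kernel a z <= a * ((1 + (2 * pi * d) ^+ 2) / (2 * pi * d) ^+ 2) * poisson_kernel 1 z.
Proof.
move=> a0 a1 d0 dz.
have p0 : 0 < (2 * pi : R) by rewrite mulr_gt0// pi_gt0.
set D := (2 * pi * d) ^+ 2; set Z := (2 * pi * z) ^+ 2.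
have D0 : 0 < D by rewrite exprn_gt0// mulr_gt0.
have DZ : D <= Z.
  rewrite /D /Z -(real_normK (num_real (2 * pi * z))) lerXn2r ?nnegrE ?normr_ge0//.
    by rewrite mulr_ge0// ltW.
  by rewrite normrM (gtr0_norm p0) ler_wpM2l// ltW.
rewrite /poisson_kernel expr1n -/Z mulr1.
apply: (@le_trans _ _ (2 * a / Z)).
  rewrite ler_wpM2l ?mulr_ge0 ?(ltW a0)// lef_pV2 ?posrE; last 2 first.
  - by rewrite ltr_pwDl ?exprn_gt0//; lra.
  - by lra.
  by rewrite lerDr sqr_ge0.
rewrite (_ : a * _ * _ = 2 * a * ((1 + D) / D / (1 + Z))); last first.
  by field; rewrite !gt_eqF//; lra.
rewrite ler_wpM2l ?mulr_ge0 ?(ltW a0)//.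
rewrite ler_pdivlMr; last by lra.
rewrite ler_pdivlMr// -mulrA mulrC ler_pdivrMr; last by lra.
by nra.
Qed.

End abel_poisson.

(** * The power spectrum of a real function *)

Section real_plancherel.
Context {R : realType}.
Local Notation leb := (@lebesgue_measure R).
Local Notation intg := (real_integrable leb setT).
Local Notation sqi := (square_integrable leb setT).
Local Notation energy := (real_energy leb setT).
Local Notation RR := (measurableTypeR R * measurableTypeR R)%type.
Implicit Types p q : R -> R.

(** The bound on the inner absolute integrals makes [f] integrable on the
product.  Integrability is asked of every section in [x], rather than of
almost every one, so that the inner integrals are real numbers. *)
Lemma Rint_fubini (f : RR -> R) (a : R -> R) :
  measurable_fun setT f -> intg a ->
  (forall x, \int[leb]_y `|(f (x, y))%:E| <= (a x)%:E)%E ->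
  (forall y, intg (fun x => f (x, y))) ->
  \int[leb]_x \int[leb]_y f (x, y) = \int[leb]_y \int[leb]_x f (x, y) /\
  intg (fun y => \int[leb]_x f (x, y)).
Proof.
move=> mf ia fa fy.
have mEf : measurable_fun setT (EFin \o f) by exact/measurable_EFinP.
have fx x : intg (fun y => f (x, y)).
  apply/integrableP; split; last by rewrite (le_lt_trans (fa x))// ltry.
  by apply: (measurableT_comp mEf); exact: pair1_measurable.
have iF : (leb \x leb)%E.-integrable setT (EFin \o f).
  apply/integrable12ltyP => //.
  apply: (@le_lt_trans _ _ (\int[leb]_x (a x)%:E)%E).
    apply: ge0_le_integral => //.
    - by move=> x _; exact: integral_ge0.
    - apply: (measurable_fun_fubini_tonelli_F (abse \o (EFin \o f))) => //.
        exact: measurableT_comp.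
      by move=> x; exact: abse_ge0.
    - by apply/measurable_EFinP; exact: intg_measurable ia.
    - by move=> x _; exact: fa.
  by rewrite -EFin_Rint// ltry.
split.
  rewrite /Rintegral; congr fine.
  under eq_integral => x _ do rewrite fineK ?(integrable_fin_num measurableT (fx x))//.
  under [RHS]eq_integral => y _ do rewrite fineK ?(integrable_fin_num measurableT (fy y))//.
  exact: (Fubini iF).
apply/integrableP; split.
  apply: eq_measurable_fun (measurable_fubini_G iF) => y _.
  by rewrite /= EFin_Rint.
apply: le_lt_trans ((integrable21ltyP _ _ mEf).1 iF).
apply: ge0_le_integral => //.
- apply: measurableT_comp => //; apply: eq_measurable_fun (measurable_fubini_G iF) => y _.
  by rewrite /= EFin_Rint.
- apply: (measurable_fun_fubini_tonelli_G (abse \o (EFin \o f))) => //.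
    exact: measurableT_comp.
  by move=> x; exact: abse_ge0.
- move=> y _; rewrite /= -[X in (X <= _)%E]/(`|_|%:E)%E EFin_normr_Rintegral//.
  by apply: le_abse_integral => //; have /integrableP[] := fy y.
exact: fy.
Qed.

(** The Fourier transform of a real function [p] is
[cos_transform p - i sin_transform p]. *)
Definition cos_transform p (w : R) : R := \int[leb]_x (p x * cos (2 * pi * w * x)).
Definition sin_transform p (w : R) : R := \int[leb]_x (p x * sin (2 * pi * w * x)).
Definition autocorr p (z : R) : R := \int[leb]_x (p x * p (x + z)).

Lemma intg_mul_cos (b : R) p : intg p -> intg (fun x => p x * cos (b * x)).
Proof.
move=> ip; apply: (le_intg measurableT _ (intg_norm ip)).
  apply: measurable_funM; first exact: intg_measurable ip.
  exact: measurable_cosM.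
by move=> x _; rewrite normrM ler_piMr// cos_max.
Qed.

Lemma intg_mul_sin (b : R) p : intg p -> intg (fun x => p x * sin (b * x)).
Proof.
move=> ip; apply: (le_intg measurableT _ (intg_norm ip)).
  apply: measurable_funM; first exact: intg_measurable ip.
  exact: measurable_sinM.
by move=> x _; rewrite normrM ler_piMr// sin_max.
Qed.

(** Polarization, together with translation invariance of the energy. *)
Lemma autocorrE p z : sqi p -> autocorr p z = energy p - 2^-1 * shift_energy p z.
Proof.
move=> sp; have sz := sqi_translate z sp.
have -> : shift_energy p z = energy (fun x : R => p (x + z) + (-1) * p x).
  by apply: eq_Rintegral => x _; rewrite mulN1r.
rewrite energyD//; last exact: sqiZ.
rewrite energyZ// energy_translate//.
have -> : \int[leb]_x (p (x + z) * (-1 * p x)) = - autocorr p z.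
  rewrite /autocorr -[RHS]mulN1r -RintegralZl//; last exact: sqi_mul.
  by apply: eq_Rintegral => x _; ring.
by field.
Qed.

(** The Wiener-Khinchin identity.  Exchanging the two integrals and substituting
[y = x + z], the addition formula for [cos (b * (y - x))] separates the
variables. *)
Lemma power_spectrum p w : intg p -> sqi p ->
  cos_transform p w ^+ 2 + sin_transform p w ^+ 2 =
    \int[leb]_z (autocorr p z * cos (2 * pi * w * z)) /\
  intg (fun z => autocorr p z * cos (2 * pi * w * z)).
Proof.
move=> ip sp; set b := 2 * pi * w.
have mp := intg_measurable ip.
pose f (xz : RR) : R := p xz.1 * (p (xz.1 + xz.2) * cos (b * xz.2)).
pose N := \int[leb]_x `|p x|.
have [||||] := @Rint_fubini f (fun x => `|p x| * N).
- apply: measurable_funM; first exact: (measurableT_comp mp measurable_fst).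
  apply: measurable_funM.
    apply: (measurableT_comp mp).
    by apply: measurable_funD; [exact: measurable_fst|exact: measurable_snd].
  exact: (measurableT_comp (measurable_cosM b) measurable_snd).
- under eq_fun do rewrite mulrC.
  exact: intgZ (intg_norm ip).
- move=> x.
  have ipx : intg (fun z => p (x + z) * cos (b * z)).
    apply: intg_mul_cos; under eq_fun do rewrite addrC.
    exact: intg_translate.
  under eq_integral => z _ do rewrite /f /= normrM EFinM.
  rewrite ge0_integralZl//; last first.
    apply/measurable_EFinP; apply: measurableT_comp => //.
    exact: intg_measurable ipx.
  rewrite EFinM lee_wpmul2l// /N EFin_Rint//; last exact: intg_norm.
  rewrite -(ge0_integral_translate x (f := fun y => `|p y|%:E))//; last first.
    by apply/measurable_EFinP; exact: measurableT_comp.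
  apply: ge0_le_integral => //.
  + apply/measurable_EFinP; apply: measurableT_comp => //.
    exact: intg_measurable ipx.
  + apply/measurable_EFinP; apply: measurableT_comp => //.
    exact: measurable_translate.
  + by move=> z _; rewrite lee_fin normrM addrC ler_piMr// cos_max.
- move=> z; have := sqi_mul measurableT sp (sqi_translate z sp).
  move=> /(intgZ measurableT (cos (b * z))).
  by apply: eq_intg => // x _; rewrite /f/=; ring.
rewrite /f /= => E I.
have iE z : \int[leb]_x (p x * (p (x + z) * cos (b * z))) = autocorr p z * cos (b * z).
  rewrite /autocorr -(RintegralZr _ measurableT (sqi_mul measurableT sp (sqi_translate z sp))).
  by apply: eq_Rintegral => x _; rewrite mulrA.
split; last by move: I; apply: eq_intg => // z _.
under [RHS]eq_Rintegral => z _ do rewrite -iE.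
rewrite -E.
have jc := intg_mul_cos b ip; have js := intg_mul_sin b ip.
have iZ c h := @intgZ _ _ _ leb setT measurableT c h.
have xE x : \int[leb]_z (p x * (p (x + z) * cos (b * z))) =
    cos_transform p w * (p x * cos (b * x)) + sin_transform p w * (p x * sin (b * x)).
  have ix : intg (fun z => p (x + z) * cos (b * z)).
    apply: intg_mul_cos; under eq_fun do rewrite addrC.
    exact: intg_translate.
  rewrite (RintegralZl (p x) measurableT ix).
  transitivity (p x * \int[leb]_y (p y * cos (b * (y - x)))).
    congr (_ * _).
    rewrite -(Rint_translate x (f := fun y => p y * cos (b * (y - x)))).
      by apply: eq_Rintegral => z _; rewrite addrK addrC.
    apply: measurable_funM => //.
    apply: (measurableT_comp (measurable_cosM b)).
    exact: measurable_funB.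
  transitivity (p x * \int[leb]_y
      (cos (b * x) * (p y * cos (b * y)) + sin (b * x) * (p y * sin (b * y)))).
    congr (_ * _); apply: eq_Rintegral => y _.
    by rewrite mulrBr cosB; ring.
  rewrite (RintegralD measurableT (iZ (cos (b * x)) _ jc) (iZ (sin (b * x)) _ js)).
  rewrite (RintegralZl (cos (b * x)) measurableT jc).
  rewrite (RintegralZl (sin (b * x)) measurableT js).
  rewrite -/(cos_transform p w) -/(sin_transform p w).
  by move: (cos_transform p w) (sin_transform p w) => C S; ring.
under [RHS]eq_Rintegral => x _ do rewrite xE.
rewrite (RintegralD measurableT (iZ (cos_transform p w) _ jc) (iZ (sin_transform p w) _ js)).
rewrite (RintegralZl (cos_transform p w) measurableT jc).
rewrite (RintegralZl (sin_transform p w) measurableT js).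
by rewrite -/(cos_transform p w) -/(sin_transform p w) !expr2.
Qed.

Lemma intg_autocorr p : intg p -> sqi p -> intg (autocorr p).
Proof.
move=> ip sp; have [_] := power_spectrum 0 ip sp.
by apply: eq_intg => // z _; rewrite mulr0 mul0r cos0 mulr1.
Qed.

(** Another exchange of integrals, in which the weight makes the integrand
integrable in [w] and turns the cosine into the Poisson kernel. *)
Lemma weighted_power p (a : R) : intg p -> sqi p -> 0 < a ->
  \int[leb]_w (abel_weight a w * (cos_transform p w ^+ 2 + sin_transform p w ^+ 2)) =
  \int[leb]_z (autocorr p z * poisson_kernel a z).
Proof.
move=> ip sp a0; have ir := intg_autocorr ip sp; have mr := intg_measurable ir.
pose f (wz : RR) : R := abel_weight a wz.1 * (autocorr p wz.2 * cos (2 * pi * wz.1 * wz.2)).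
pose N := \int[leb]_z `|autocorr p z|.
have [||||] := @Rint_fubini f (fun w => abel_weight a w * N).
- apply: measurable_funM; first exact: (measurableT_comp (measurable_abel_weight a) measurable_fst).
  apply: measurable_funM; first exact: (measurableT_comp mr measurable_snd).
  apply: (measurableT_comp (continuous_measurable_fun (@continuous_cos R))).
  apply: measurable_funM; last exact: measurable_snd.
  by apply: measurable_funM => //; exact: measurable_fst.
- under eq_fun do rewrite mulrC.
  exact: intgZ (intg_abel_weight a0).
- move=> w; have [_ ipw] := power_spectrum w ip sp.
  under eq_integral => z _ do rewrite /f /= normrM (ger0_norm (abel_weight_ge0 _ _)) EFinM.
  rewrite ge0_integralZl//; last 2 first.
  + apply/measurable_EFinP; apply: measurableT_comp => //.
    exact: intg_measurable ipw.
  + by rewrite lee_fin abel_weight_ge0.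
  rewrite EFinM lee_wpmul2l ?lee_fin ?abel_weight_ge0// /N EFin_Rint//; last exact: intg_norm.
  apply: ge0_le_integral => //.
  + apply/measurable_EFinP; apply: measurableT_comp => //.
    exact: intg_measurable ipw.
  + by apply/measurable_EFinP; apply: measurableT_comp.
  + by move=> z _; rewrite lee_fin normrM ler_piMr// cos_max.
- move=> z; have := intgZ measurableT (autocorr p z) (intg_abel_weight_cos (2 * pi * z) a0).
  by apply: eq_intg => // x _; rewrite /f/= (_ : 2 * pi * x * z = 2 * pi * z * x); ring.
rewrite /f /= => E _.
transitivity (\int[leb]_w \int[leb]_z (abel_weight a w * (autocorr p z * cos (2 * pi * w * z)))).
  apply: eq_Rintegral => w _; have [-> ipw] := power_spectrum w ip sp.
  by rewrite RintegralZl.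
rewrite E; apply: eq_Rintegral => z _.
rewrite -(integral_abel_weight_cos z a0).
rewrite -(RintegralZl _ measurableT (intg_abel_weight_cos (2 * pi * z) a0)).
by apply: eq_Rintegral => w _; rewrite (_ : 2 * pi * w * z = 2 * pi * z * w); ring.
Qed.

End real_plancherel.

(** * Plancherel's identity on integrable square-integrable functions *)

Section real_plancherel_limit.
Context {R : realType}.
Local Notation leb := (@lebesgue_measure R).
Local Notation intg := (real_integrable leb setT).
Local Notation sqi := (square_integrable leb setT).
Local Notation energy := (real_energy leb setT).
Local Notation RR := (measurableTypeR R * measurableTypeR R)%type.
Implicit Types p q : R -> R.

(** By [autocorrE] the difference is half the average of [shift_energy p]
against the kernel.  Near the origin the shift energy is small, and far from
it the kernel carries a mass of order [a]. *)
Lemma autocorr_poisson_cvg p : intg p -> sqi p ->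
  \int[leb]_z (autocorr p z * poisson_kernel n.+1%:R^-1 z) @[n --> \oo] --> energy p.
Proof.
move=> ip sp; have mr := intg_measurable (intg_autocorr ip sp).
have E0 : 0 <= energy p := energy_ge0 _ _ _.
have an0 n : 0 < n.+1%:R^-1 :> R by rewrite invr_gt0.
have an1 n : n.+1%:R^-1 <= 1 :> R by rewrite invf_le1// ler1n.
have irP (a : R) : 0 < a -> intg (fun z => autocorr p z * poisson_kernel a z).
  move=> a0; apply: (le_intg measurableT _ (intgZ measurableT (3 * energy p) (intg_poisson a0))).
    by apply: measurable_funM => //; exact: measurable_poisson.
  move=> z _; rewrite normrM (ger0_norm (poisson_ge0 _ a0)) ler_wpM2r ?poisson_ge0//.
  rewrite autocorrE// ler_norml.
  move: (shift_energy_ge0 p z) (shift_energy_le z sp) E0.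
  move: (shift_energy p z) (energy p) => v E; lra.
apply/cvgrPdist_le => e e0.
have [d [d0 dP]] := shift_energy_cvg0 sp e0.
pose K : R := ((1 + (2 * pi * d) ^+ 2) / (2 * pi * d) ^+ 2) * (4 * energy p).
have K0 : 0 <= K.
  apply: mulr_ge0; last by rewrite mulr_ge0.
  by apply: divr_ge0; rewrite ?addr_ge0 ?sqr_ge0.
(* [K] is such that the mass far from the origin contributes at most [a * K] *)
suff H (a : R) : 0 < a -> a <= 1 -> a * K <= e ->
    `|energy p - \int[leb]_z (autocorr p z * poisson_kernel a z)| <= e.
  near=> n; apply: H => //.
  rewrite ler_pdivrMl// -ler_pdivrMr// -natr1 ler_wpDr//.
  by near: n; exact: nbhs_infty_ger.
move=> a0 a1 aK.
have -> : energy p = \int[leb]_z (energy p * poisson_kernel a z).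
  by rewrite RintegralZl// ?integral_poisson ?mulr1//; exact: intg_poisson.
rewrite -RintegralB//; [|exact: intgZ (intg_poisson a0)|exact: irP].
rewrite ger0_norm; last first.
  apply: Rintegral_ge0 => z _; rewrite -mulrBl mulr_ge0 ?poisson_ge0// autocorrE//.
  by have := shift_energy_ge0 p z; lra.
apply: (@le_trans _ _ (\int[leb]_z
    (2^-1 * (e * poisson_kernel a z) + 2^-1 * (a * K * poisson_kernel 1 z)))).
  apply: le_Rintegral => //.
  - by apply: intgB => //; [exact: intgZ (intg_poisson a0)|exact: irP].
  - by apply: intgD => //; do 2 apply: intgZ => //; exact: intg_poisson.
  - move=> z _.
    have -> : energy p * poisson_kernel a z - autocorr p z * poisson_kernel a z =
        2^-1 * (shift_energy p z * poisson_kernel a z) by rewrite autocorrE//; ring.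
    rewrite -mulrDr ler_wpM2l//.
    have [zd|zd] := ltP `|z| d.
      apply: (@le_trans _ _ (e * poisson_kernel a z)).
        by rewrite ler_wpM2r ?poisson_ge0 ?dP.
      by rewrite lerDl mulr_ge0 ?poisson_ge0// mulr_ge0// ltW.
    apply: (@le_trans _ _ (a * K * poisson_kernel 1 z)); last first.
      by rewrite lerDr mulr_ge0 ?poisson_ge0// ltW.
    apply: (@le_trans _ _ (4 * energy p * poisson_kernel a z)).
      by rewrite ler_wpM2r ?poisson_ge0// shift_energy_le.
    have -> : a * K * poisson_kernel 1 z = 4 * energy p *
        (a * ((1 + (2 * pi * d) ^+ 2) / (2 * pi * d) ^+ 2) * poisson_kernel 1 z).
      by rewrite /K; ring.
    by rewrite ler_wpM2l ?mulr_ge0// poisson_tail.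
have PE (c b : R) : 0 < b -> \int[leb]_z (c * poisson_kernel b z) = c.
  move=> b0; rewrite (RintegralZl _ measurableT (intg_poisson b0)).
  by rewrite integral_poisson ?mulr1.
under eq_Rintegral => z _ do rewrite !(mulrA 2^-1).
rewrite RintegralD//; try by apply: intgZ => //; exact: intg_poisson.
rewrite !PE//; lra.
Unshelve. all: end_near. Qed.

(** Measurability of a partial integral comes with Fubini's theorem, which needs
an integrand that is also integrable in [w].  The Abel weight provides this
and, being positive, can be divided out again. *)
Lemma measurable_trig_transform p (t : R -> R) : intg p ->
  measurable_fun setT t -> (forall x, `|t x| <= 1) ->
  measurable_fun setT (fun w : R => \int[leb]_x (p x * t (2 * pi * w * x))).
Proof.
move=> ip mt t1; have mp := intg_measurable ip.
pose f (xw : RR) : R := p xw.1 * (abel_weight 1 xw.2 * t (2 * pi * xw.2 * xw.1)).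
have mtb (b : R) : measurable_fun setT (fun x : R => t (b * x)).
  by apply: (measurableT_comp mt); exact: measurable_funM.
have mtb' (b : R) : measurable_fun setT (fun w : R => t (2 * pi * w * b)).
  by apply: (measurableT_comp mt); do 2 apply: measurable_funM => //.
have itb (b : R) : intg (fun x => p x * t (b * x)).
  apply: (le_intg measurableT _ (intg_norm ip)); first exact: measurable_funM mp (mtb b).
  by move=> x _; rewrite normrM ler_piMr.
have [||||_ I] := @Rint_fubini R f (fun x => 2 * `|p x|).
- apply: measurable_funM; first exact: (measurableT_comp mp measurable_fst).
  apply: measurable_funM; first exact: (measurableT_comp (measurable_abel_weight 1) measurable_snd).
  apply: (measurableT_comp mt).
  apply: measurable_funM; last exact: measurable_fst.
  by apply: measurable_funM => //; exact: measurable_snd.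
- by apply: intgZ => //; exact: intg_norm.
- move=> x; under eq_integral => w _ do rewrite /f /= normrM EFinM.
  rewrite ge0_integralZl//; last first.
    apply/measurable_EFinP; apply: measurableT_comp => //.
    exact: measurable_funM (measurable_abel_weight 1) (mtb' x).
  rewrite (_ : (2 * `|p x|)%:E = (`|p x|%:E * 2%:E)%E); last by rewrite -EFinM mulrC.
  rewrite lee_wpmul2l//.
  have L2 : \int[leb]_w abel_weight 1 w = 2 by rewrite integral_abel_weight// divr1.
  rewrite -[X in (_ <= X%:E)%E]L2.
  rewrite EFin_Rint//; last exact: intg_abel_weight.
  apply: ge0_le_integral => //.
  + apply/measurable_EFinP; apply: measurableT_comp => //.
    exact: measurable_funM (measurable_abel_weight 1) (mtb' x).
  + by apply/measurable_EFinP; exact: measurable_abel_weight.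
  + move=> w _; rewrite lee_fin normrM (ger0_norm (abel_weight_ge0 _ _)).
    by rewrite ler_piMr// abel_weight_ge0.
- move=> w; apply: (eq_intg measurableT _ (intgZ measurableT (abel_weight 1 w) (itb (2 * pi * w)))).
  by move=> x _; rewrite /f/=; ring.
have H : continuous (fun w : R => expR `|w|).
  move=> w; apply: (@continuous_comp _ _ _ (fun r : R => `|r|) expR); last exact: continuous_expR.
  exact: norm_continuous.
have := measurable_funM (intg_measurable I) (continuous_measurable_fun H).
congr measurable_fun; apply/funext => w /=.
rewrite (_ : Rintegral _ _ _ = \int[leb]_x (abel_weight 1 w * (p x * t (2 * pi * w * x)))).
  rewrite (RintegralZl _ measurableT (itb _)).
  by rewrite mulrAC /abel_weight -expRD mul1r addNr expR0 mul1r.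
by apply: eq_Rintegral => x _; rewrite /f/=; ring.
Qed.

Lemma measurable_cos_transform p : intg p -> measurable_fun setT (cos_transform p).
Proof.
move=> ip; apply: (measurable_trig_transform ip (continuous_measurable_fun (@continuous_cos R))).
by move=> x; exact: cos_max.
Qed.

Lemma measurable_sin_transform p : intg p -> measurable_fun setT (sin_transform p).
Proof.
move=> ip; apply: (measurable_trig_transform ip (continuous_measurable_fun (@continuous_sin R))).
by move=> x; exact: sin_max.
Qed.

Lemma cos_transform_le p w : intg p -> `|cos_transform p w| <= \int[leb]_x `|p x|.
Proof.
move=> ip; apply: (le_trans (le_normr_Rintegral _ (intg_mul_cos _ ip))) => //.
apply: le_Rintegral => //; [exact: intg_norm (intg_mul_cos _ ip)|exact: intg_norm|].
by move=> x _; rewrite normrM ler_piMr// cos_max.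
Qed.

Lemma sin_transform_le p w : intg p -> `|sin_transform p w| <= \int[leb]_x `|p x|.
Proof.
move=> ip; apply: (le_trans (le_normr_Rintegral _ (intg_mul_sin _ ip))) => //.
apply: le_Rintegral => //; [exact: intg_norm (intg_mul_sin _ ip)|exact: intg_norm|].
by move=> x _; rewrite normrM ler_piMr// sin_max.
Qed.

(** The Abel weights increase to 1, so monotone convergence identifies the
energy of the transform with the limit found in [autocorr_poisson_cvg]. *)
Lemma plancherel_real p : intg p -> sqi p ->
  [/\ sqi (cos_transform p), sqi (sin_transform p) &
      energy (cos_transform p) + energy (sin_transform p) = energy p].
Proof.
move=> ip sp.
have mc := measurable_cos_transform ip; have ms := measurable_sin_transform ip.
pose S w := cos_transform p w ^+ 2 + sin_transform p w ^+ 2.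
have S0 w : 0 <= S w by rewrite addr_ge0 ?sqr_ge0.
have mS : measurable_fun setT S by apply: measurable_funD; exact: measurable_funX.
pose N := \int[leb]_x `|p x|.
have SN w : S w <= 2 * N ^+ 2.
  rewrite mulr_natl mulr2n lerD//.
    rewrite -(real_normK (num_real (cos_transform p w))).
    by rewrite lerXn2r ?nnegrE ?cos_transform_le// Rintegral_ge0.
  rewrite -(real_normK (num_real (sin_transform p w))).
  by rewrite lerXn2r ?nnegrE ?sin_transform_le// Rintegral_ge0.
have an0 n : 0 < n.+1%:R^-1 :> R by rewrite invr_gt0.
have iLS (a : R) : 0 < a -> intg (fun w => abel_weight a w * S w).
  move=> a0; apply: (le_intg measurableT _ (intgZ measurableT (2 * N ^+ 2) (intg_abel_weight a0))).
    exact: measurable_funM (measurable_abel_weight a) mS.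
  move=> w _; rewrite normrM (ger0_norm (abel_weight_ge0 _ _)) (ger0_norm (S0 _)) mulrC.
  by rewrite ler_wpM2r ?abel_weight_ge0.
have c1 : (\int[leb]_w (abel_weight n.+1%:R^-1 w * S w)%:E @[n --> \oo] --> \int[leb]_w (S w)%:E)%E.
  have -> : (\int[leb]_w (S w)%:E =
      \int[leb]_w limn (fun n => (abel_weight n.+1%:R^-1 w * S w)%:E))%E.
    apply: eq_integral => w _; apply/esym/cvg_lim => //.
    apply: cvg_EFin; first exact: nearW.
    rewrite -[X in _ --> X]mul1r; apply: cvgM; last exact: cvg_cst.
    rewrite -[X in _ --> X](expR0).
    apply: (@cvg_comp _ _ _ (fun n : nat => - (n.+1%:R^-1 * `|w|)) expR _ (nbhs (0:R)));
      last exact: continuous_expR.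
    suff : - (n.+1%:R^-1 * `|w|) @[n --> \oo] --> - (0 * `|w|) by rewrite mul0r oppr0.
    by apply: cvgN; apply: cvgM; [exact: cvg_harmonic|exact: cvg_cst].
  apply: cvg_monotone_convergence => //.
  - move=> n; apply/measurable_EFinP; apply: measurable_funM => //.
    exact: measurable_abel_weight.
  - by move=> n w _; rewrite lee_fin mulr_ge0 ?abel_weight_ge0.
  - move=> w _ n m nm; rewrite lee_fin ler_wpM2r// ler_expR lerN2 ler_wpM2r//.
    by rewrite lef_pV2 ?posrE// ler_nat.
have c2 : (\int[leb]_w (abel_weight n.+1%:R^-1 w * S w)%:E @[n --> \oo] --> (energy p)%:E)%E.
  apply: cvg_EFin.
    by apply: nearW => n; exact: (integrable_fin_num measurableT (iLS _ (an0 n))).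
  apply: cvg_trans (autocorr_poisson_cvg ip sp); apply: near_eq_cvg; apply: nearW => n.
  by rewrite -weighted_power.
have ES := cvg_unique (@ereal_hausdorff R) c1 c2.
have iS : intg S by apply: ge0_intg => //; rewrite ES ?ltry//.
have sc : sqi (cos_transform p).
  split => //; apply: (le_intg measurableT _ iS); first exact: measurable_funX.
  by move=> w _; rewrite ger0_norm ?sqr_ge0// lerDl sqr_ge0.
have ss : sqi (sin_transform p).
  split => //; apply: (le_intg measurableT _ iS); first exact: measurable_funX.
  by move=> w _; rewrite ger0_norm ?sqr_ge0// lerDr sqr_ge0.
have H := EFin_Rint measurableT iS; rewrite ES in H.
have ES' : \int[leb]_w S w = energy p by case: H.
split => //; rewrite -ES' /energy -RintegralD//; [exact: sc.2|exact: ss.2].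
Qed.

End real_plancherel_limit.

(** * Complex square-integrable functions *)

Section complex_L2.
Context d (T : measurableType d) (R : realType).
Variables (mu : {measure set T -> \bar R}) (D : set T) (mD : measurable D).
Implicit Types f g : T -> R[i].
Local Notation re f := (fun x => complex.Re (f x)).
Local Notation im f := (fun x => complex.Im (f x)).

Local Notation intg := (real_integrable mu D).
Local Notation sqi := (square_integrable mu D).
Local Notation energy := (real_energy mu D).

Definition complex_square_integrable f := sqi (re f) /\ sqi (im f).
Definition complex_energy f : R := energy (re f) + energy (im f).

Local Notation csqi := complex_square_integrable.
Local Notation cenergy := complex_energy.

Lemma normc_sqr (z : R[i]) : Normc.normc z ^+ 2 = complex.Re z ^+ 2 + complex.Im z ^+ 2.
Proof. by case: z => a b /=; rewrite sqr_sqrtr// addr_ge0 ?sqr_ge0. Qed.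

Lemma normc_ge0 (z : R[i]) : 0 <= Normc.normc z.
Proof. by case: z => a b /=; exact: sqrtr_ge0. Qed.

Lemma L2norm_sqr (h : T -> \bar R) : (forall x, D x -> 0 <= h x)%E ->
  (L2norm mu D h `^ 2 = \int[mu]_(x in D) (h x `^ 2))%E.
Proof.
move=> h0; rewrite /L2norm poweR_Lnorm// [RHS]integral_mkcond.
apply: eq_integral => x _; rewrite !patchE; case: ifPn => [/set_mem Dx|_].
  by rewrite gee0_abs// h0.
by rewrite abse0 poweR0r.
Qed.

Lemma L2norm_modulus_sqr f :
  (L2norm mu D (modulus f) `^ 2 =
   \int[mu]_(x in D) (complex.Re (f x) ^+ 2 + complex.Im (f x) ^+ 2)%:E)%E.
Proof.
rewrite L2norm_sqr; last by move=> x _; rewrite lee_fin normc_ge0.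
apply: eq_integral => x _; rewrite /modulus poweR_EFin.
by rewrite powR_mulrn ?normc_ge0// normc_sqr.
Qed.

Lemma csqi_intg f : csqi f -> intg (fun x => complex.Re (f x) ^+ 2 + complex.Im (f x) ^+ 2).
Proof. by move=> [sr si]; apply: intgD => //; [exact: sr.2|exact: si.2]. Qed.

Lemma cenergyE f : csqi f ->
  cenergy f = \int[mu]_(x in D) (complex.Re (f x) ^+ 2 + complex.Im (f x) ^+ 2).
Proof. by move=> [sr si]; rewrite RintegralD//; [exact: sr.2|exact: si.2]. Qed.

Lemma EFin_cenergy f : csqi f -> ((cenergy f)%:E =
  \int[mu]_(x in D) (complex.Re (f x) ^+ 2 + complex.Im (f x) ^+ 2)%:E)%E.
Proof. by move=> sf; rewrite cenergyE// EFin_Rint//; exact: csqi_intg. Qed.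

Lemma L2_csqi f : L2 mu D f -> csqi f.
Proof.
move=> [[mr mi] foo].
have m2 : measurable_fun D (fun x => complex.Re (f x) ^+ 2 + complex.Im (f x) ^+ 2).
  by apply: measurable_funD; exact: measurable_funX.
have i2 : intg (fun x => complex.Re (f x) ^+ 2 + complex.Im (f x) ^+ 2).
  apply: ge0_intg => //; first by move=> x _; rewrite addr_ge0 ?sqr_ge0.
  by rewrite -L2norm_modulus_sqr poweR_lty.
split; split => //.
- apply: (le_intg mD _ i2); first exact: measurable_funX.
  by move=> x _; rewrite ger0_norm ?sqr_ge0// lerDl sqr_ge0.
- apply: (le_intg mD _ i2); first exact: measurable_funX.
  by move=> x _; rewrite ger0_norm ?sqr_ge0// lerDr sqr_ge0.
Qed.

Lemma cenergy_ge0 f : 0 <= cenergy f.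
Proof. by rewrite addr_ge0 ?energy_ge0. Qed.

Lemma L2norm_cenergy f : csqi f ->
  L2norm mu D (modulus f) = (Num.sqrt (cenergy f))%:E.
Proof.
move=> sf; have := L2norm_modulus_sqr f; rewrite -EFin_cenergy//.
have : (0 <= L2norm mu D (modulus f))%E by exact: Lnorm_ge0.
case: (L2norm mu D (modulus f)) => [l| |//] l0.
- rewrite poweR_EFin powR_mulrn// => -[<-].
  by rewrite sqrtr_sqr ger0_norm.
- by rewrite poweRyr.
Qed.

Lemma csqi_L2 f : csqi f -> L2 mu D f.
Proof.
move=> sf; split; first by split; [exact: sf.1.1|exact: sf.2.1].
by rewrite L2norm_cenergy// ltry.
Qed.

Lemma csqiD f g : csqi f -> csqi g -> csqi (fun x => f x + g x).
Proof.
move=> [fr fi] [gr gi]; split.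
  have := sqiD mD fr gr; congr square_integrable; apply/funext => x.
  by case: (f x) (g x) => ? ? [].
have := sqiD mD fi gi; congr square_integrable; apply/funext => x.
by case: (f x) (g x) => ? ? [].
Qed.

Lemma csqiZ (c : R) f : csqi f -> csqi (fun x => c%:C%C * f x).
Proof.
move=> [fr fi]; split.
  have := sqiZ mD c fr; congr square_integrable; apply/funext => x.
  by case: (f x) => ? ? /=; rewrite mul0r subr0.
have := sqiZ mD c fi; congr square_integrable; apply/funext => x.
by case: (f x) => ? ? /=; rewrite mul0r addr0.
Qed.

Lemma csqiB f g : csqi f -> csqi g -> csqi (fun x => f x - g x).
Proof.
move=> [fr fi] [gr gi]; split.
  have := sqiB mD fr gr; congr square_integrable; apply/funext => x.
  by case: (f x) (g x) => ? ? [].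
have := sqiB mD fi gi; congr square_integrable; apply/funext => x.
by case: (f x) (g x) => ? ? [].
Qed.

Lemma cenergyD_le f g : csqi f -> csqi g ->
  cenergy (fun x => f x + g x) <= 2 * cenergy f + 2 * cenergy g.
Proof.
move=> [fr fi] [gr gi]; rewrite /cenergy.
have := energyD_le mD fr gr; have := energyD_le mD fi gi.
have -> : energy (re (fun x => f x + g x)) =
    energy (fun x => complex.Re (f x) + complex.Re (g x)).
  by apply: eq_Rintegral => x _; case: (f x) (g x) => ? ? [].
have -> : energy (im (fun x => f x + g x)) =
    energy (fun x => complex.Im (f x) + complex.Im (g x)).
  by apply: eq_Rintegral => x _; case: (f x) (g x) => ? ? [].
move=> H1 H2; lra.
Qed.

(** [f = (f - g) + g]: an estimate for [f] follows from one for a nearby [g]. *)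
Lemma cenergy_le_dist f g : csqi f -> csqi g ->
  cenergy f <= 2 * cenergy (fun x => f x - g x) + 2 * cenergy g.
Proof.
move=> sf sg; have := cenergyD_le (csqiB sf sg) sg.
by under [X in cenergy X]eq_fun do rewrite subrK.
Qed.

Lemma cenergy_distC f g : cenergy (fun x => f x - g x) = cenergy (fun x => g x - f x).
Proof.
congr (_ + _); apply: eq_Rintegral => x _; case: (f x) (g x) => a b [c e] /=; ring.
Qed.

Lemma cenergy_ae f g : csqi f -> csqi g -> f = g %[ae mu in D] -> cenergy f = cenergy g.
Proof.
move=> sf sg fg; apply: EFin_inj; rewrite !EFin_cenergy//.
apply: ae_eq_integral => //.
- by apply/measurable_EFinP; exact: intg_measurable (csqi_intg sf).
- by apply/measurable_EFinP; exact: intg_measurable (csqi_intg sg).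
- by apply: filterS fg => x fgx Dx; rewrite fgx.
Qed.

Lemma L2_cvg_cenergy (u : nat -> T -> R[i]) f : (forall n, csqi (u n)) -> csqi f ->
  L2_cvg mu D u f -> cenergy (fun x => u n x - f x) @[n --> \oo] --> 0.
Proof.
move=> su sf uf.
have suf n : csqi (fun x => u n x - f x) by exact: csqiB.
have H0 : (Num.sqrt (cenergy (fun x => u n x - f x)))%:E @[n --> \oo] --> 0%E.
  by apply: cvg_trans uf; apply: near_eq_cvg; apply: nearW => n; rewrite L2norm_cenergy.
have H : Num.sqrt (cenergy (fun x => u n x - f x)) @[n --> \oo] --> (0 : R) by exact: fine_cvg H0.
rewrite -[X in _ --> X](mulr0 (0 : R)).
have -> : (fun n => cenergy (fun x => u n x - f x)) =
    (fun n => Num.sqrt (cenergy (fun x => u n x - f x)) *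
              Num.sqrt (cenergy (fun x => u n x - f x))).
  by apply/funext => n; rewrite -expr2 sqr_sqrtr// cenergy_ge0.
exact: cvgM.
Qed.

End complex_L2.

(** * Plancherel's identity for complex functions and its extension to L^2 *)

Section complex_plancherel.
Context {R : realType}.
Local Notation leb := (@lebesgue_measure R).
Local Notation intg := (real_integrable leb setT).
Local Notation sqi := (square_integrable leb setT).
Local Notation energy := (real_energy leb setT).
Local Notation csqi := (complex_square_integrable leb setT).
Local Notation cintg := (cintegrable leb setT).
Local Notation cenergy := (complex_energy leb setT).
Implicit Types f g h u v : R -> R[i].

Lemma fourierE u w : cintg u -> fourier u w =
  ((cos_transform (fun x => complex.Re (u x)) w + sin_transform (fun x => complex.Im (u x)) w) +i*
   (cos_transform (fun x => complex.Im (u x)) w - sin_transform (fun x => complex.Re (u x)) w))%C.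
Proof.
move=> [ir ii]; rewrite /fourier /cintegral.
rewrite -RintegralD//; [|exact: intg_mul_cos|exact: intg_mul_sin].
rewrite -RintegralB//; [|exact: intg_mul_cos|exact: intg_mul_sin].
by congr (_ +i* _)%C; apply: eq_Rintegral => x _; case: (u x) => a b /=; ring.
Qed.

Lemma cos_transformN p w : cos_transform p (- w) = cos_transform p w :> R.
Proof. by apply: eq_Rintegral => x _; rewrite mulrN mulNr cosN. Qed.

Lemma sin_transformN p w : intg p -> sin_transform p (- w) = - sin_transform p w.
Proof.
move=> ip; rewrite /sin_transform -[RHS]mulN1r -RintegralZl//; last exact: intg_mul_sin.
by apply: eq_Rintegral => x _; rewrite mulrN mulNr sinN; ring.
Qed.

(** The cosine transform is even and the sine transform is odd. *)
Lemma Rint_cos_transform_sin_transform (p q : R -> R) : intg p -> intg q -> sqi p ->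
  sqi q ->
  \int[leb]_w (cos_transform p w * sin_transform q w) = 0.
Proof.
move=> ip iq sp sq.
have [sc _ _] := plancherel_real ip sp; have [_ ss _] := plancherel_real iq sq.
have ics := sqi_mul measurableT sc ss.
have mcs := intg_measurable ics.
have E := integral_reflect ((measurable_EFinP _ _).2 mcs).
have : \int[leb]_w (cos_transform p w * sin_transform q w) =
    - \int[leb]_w (cos_transform p w * sin_transform q w).
  rewrite -[RHS]mulN1r -(RintegralZl _ measurableT ics).
  transitivity (\int[leb]_w (cos_transform p (- w) * sin_transform q (- w))).
    exact/esym/(congr1 fine E).
  by apply: eq_Rintegral => w _; rewrite cos_transformN (sin_transformN _ iq) mulrN mulN1r.
by move=> /esym/eqP; rewrite eqNr => /eqP.
Qed.

(** The mixed terms of [|fourier u|^2] couple a cosine transform with a sine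
transform, hence integrate to zero; the rest is [plancherel_real] for the real
and imaginary parts. *)
Lemma plancherel u : cintg u -> csqi u ->
  csqi (fourier u) /\ cenergy (fourier u) = cenergy u.
Proof.
move=> iu su; have [ir ii] := iu; have [sr si] := su.
set p := fun x => complex.Re (u x) in ir sr; set q := fun x => complex.Im (u x) in ii si.
have [scp ssp Ep] := plancherel_real ir sr.
have [scq ssq Eq] := plancherel_real ii si.
have rE : (fun w => complex.Re (fourier u w)) = (fun w => cos_transform p w + sin_transform q w).
  by apply/funext => w; rewrite fourierE.
have iE : (fun w => complex.Im (fourier u w)) =
    (fun w => cos_transform q w + (-1) * sin_transform p w).
  by apply/funext => w; rewrite fourierE//= mulN1r.
have snp := sqiZ measurableT (-1) ssp.
have X1 := Rint_cos_transform_sin_transform ir ii sr si.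
have X2 : \int[leb]_x (cos_transform q x * (-1 * sin_transform p x)) = 0.
  rewrite -(mulr0 (-1)) -(Rint_cos_transform_sin_transform ii ir si sr).
  rewrite -(RintegralZl _ measurableT (sqi_mul measurableT scq ssp)).
  by apply: eq_Rintegral => x _; rewrite mulrCA.
split; first by split; rewrite ?rE ?iE; exact: sqiD.
rewrite /complex_energy rE iE (energyD measurableT scp ssq) (energyD measurableT scq snp).
rewrite (energyZ measurableT (-1) ssp) X1 X2 -/p -/q -Ep -Eq.
move: (energy (cos_transform p)) (energy (sin_transform p)) => a b.
move: (energy (cos_transform q)) (energy (sin_transform q)) => c d.
by ring.
Qed.

Lemma cintgB u v : cintg u -> cintg v -> cintg (fun x => u x - v x).
Proof.
move=> iu iv; split.
  apply: (eq_intg measurableT _ (intgB measurableT iu.1 iv.1)) => x _.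
  by case: (u x) (v x) => ? ? [].
apply: (eq_intg measurableT _ (intgB measurableT iu.2 iv.2)) => x _.
by case: (u x) (v x) => ? ? [].
Qed.

Lemma fourierB u v w : cintg u -> cintg v ->
  fourier (fun x => u x - v x) w = fourier u w - fourier v w.
Proof.
move=> iu iv.
have iuv := cintgB iu iv.
have lin (t : R -> R) (a b c : R -> R) : (forall x, c x = a x - b x) ->
    intg (fun x => a x * t x) -> intg (fun x => b x * t x) ->
    \int[leb]_x (c x * t x) = \int[leb]_x (a x * t x) - \int[leb]_x (b x * t x).
  move=> cE ia ib; rewrite -RintegralB//.
  by apply: eq_Rintegral => x _; rewrite cE mulrBl.
have rE x : complex.Re (u x - v x) = complex.Re (u x) - complex.Re (v x).
  by case: (u x) (v x) => ? ? [].
have iE x : complex.Im (u x - v x) = complex.Im (u x) - complex.Im (v x).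
  by case: (u x) (v x) => ? ? [].
rewrite !fourierE// /cos_transform /sin_transform.
rewrite (lin _ _ _ _ rE (intg_mul_cos _ iu.1) (intg_mul_cos _ iv.1)).
rewrite (lin _ _ _ _ rE (intg_mul_sin _ iu.1) (intg_mul_sin _ iv.1)).
rewrite (lin _ _ _ _ iE (intg_mul_cos _ iu.2) (intg_mul_cos _ iv.2)).
rewrite (lin _ _ _ _ iE (intg_mul_sin _ iu.2) (intg_mul_sin _ iv.2)).
have cB (a b c e : R) : ((a +i* b) - (c +i* e) = (a - c) +i* (b - e))%C by [].
by rewrite cB; congr (_ +i* _)%C; rewrite !opprD ?opprK addrACA.
Qed.

Let chain2 (x a b c e d : R) : x <= 2 * a + 2 * b -> b <= 2 * c + 2 * e ->
  a <= d / 6 -> c <= d / 6 -> x <= 4 * e + d.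
Proof. lra. Qed.

Lemma is_plancherel_approx f h (e : R) : is_plancherel f h -> 0 < e ->
  exists u, [/\ cintg u, csqi u, cenergy (fun x => f x - u x) <= e &
                cenergy (fun w => h w - fourier u w) <= e].
Proof.
move=> [/(L2_csqi measurableT) sf /(L2_csqi measurableT) sh [u [uP uf uh]]] e0.
have iu n : cintg (u n) := (uP n).1.
have su n : csqi (u n) by apply: L2_csqi => //; exact: (uP n).2.
have {}uf := L2_cvg_cenergy measurableT su sf uf.
have {}uh := L2_cvg_cenergy measurableT (fun n => (plancherel (iu n) (su n)).1) sh uh.
move/cvgrPdist_le : uf => /(_ e e0) uf; move/cvgrPdist_le : uh => /(_ e e0) uh.
have [n [n1 n2]] : exists n, `|0 - cenergy (fun x => u n x - f x)| <= e /\
    `|0 - cenergy (fun x => fourier (u n) x - h x)| <= e.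
  by near \oo => n; exists n; split; near: n.
exists (u n); split => //.
  by rewrite cenergy_distC; move: n1; rewrite sub0r normrN; apply: le_trans (ler_norm _).
by rewrite cenergy_distC; move: n2; rewrite sub0r normrN; apply: le_trans (ler_norm _).
Unshelve. all: end_near. Qed.

(** True with constant 1.  The constant 4 comes from [cenergy_le_dist], applied
on either side of the isometry to an approximation of [f]. *)
Lemma is_plancherel_le f h : is_plancherel f h -> cenergy f <= 4 * cenergy h.
Proof.
move=> fh; have [/(L2_csqi measurableT) sf /(L2_csqi measurableT) sh _] := fh.
apply/ler_addgt0Pr => e e0.
have [|u [iu su fu hu]] := @is_plancherel_approx f h (e / 6) fh; first by rewrite divr_gt0.
have [sF EF] := plancherel iu su.
have H1 := cenergy_le_dist measurableT sf su.
have H2 := cenergy_le_dist measurableT sF sh; rewrite cenergy_distC EF in H2.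
exact: chain2 H1 H2 fu hu.
Qed.

(** Since [v] is integrable, the isometry applies to its difference with an
approximation of [f]. *)
Lemma is_plancherel_dist f h v : is_plancherel f h -> cintg v -> csqi v ->
  cenergy (fun w => h w - fourier v w) <= 4 * cenergy (fun x => f x - v x).
Proof.
move=> fh iv sv; have [/(L2_csqi measurableT) sf /(L2_csqi measurableT) sh _] := fh.
apply/ler_addgt0Pr => e e0.
have [|u [iu su fu hu]] := @is_plancherel_approx f h (e / 6) fh; first by rewrite divr_gt0.
have [sF EF] := plancherel iu su; have [sV EV] := plancherel iv sv.
have suv := csqiB measurableT su sv.
have iuv := cintgB iu iv.
have [_ EUV] := plancherel iuv suv.
have := cenergyD_le measurableT (csqiB measurableT sh sF) (csqiB measurableT sF sV).
have -> : (fun x => h x - fourier u x + (fourier u x - fourier v x)) = (fun x => h x - fourier v x).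
  by apply/funext => x; rewrite addrA subrK.
have -> : cenergy (fun x => fourier u x - fourier v x) = cenergy (fun x => u x - v x).
  by rewrite -EUV; congr (complex_energy _ _ _); apply/funext => w; rewrite fourierB.
have := cenergyD_le measurableT (csqiB measurableT su sf) (csqiB measurableT sf sv).
have -> : (fun x => u x - f x + (f x - v x)) = (fun x => u x - v x).
  by apply/funext => x; rewrite addrA subrK.
have fuC : cenergy (fun x => u x - f x) = cenergy (fun x => f x - u x) by exact: cenergy_distC.
rewrite fuC => H1 H2; exact: chain2 H2 H1 hu fu.
Qed.

End complex_plancherel.

(** * The Haar measure as the image of Lebesgue measure *)

Section haar_transport.
Context {R : realType}.
Local Notation leb := (@lebesgue_measure R).

Lemma Rplus_expR (x : R) : Rplus (expR x).
Proof. by rewrite /Rplus /= in_itv/= andbT expR_gt0. Qed.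

Lemma measurable_Rplus : measurable (Rplus : set (measurableTypeR R)).
Proof. exact: measurable_itv. Qed.

Lemma haar_setIRplus (A : set (measurableTypeR R)) : haar (A `&` Rplus) = haar A.
Proof. by rewrite /haar -setIA setIid. Qed.

(** Lebesgue measure is determined by its values on half-open intervals, and
there the logarithm is a primitive of the density of the Haar measure. *)
Let lebesgue_haar (B : set (measurableTypeR R)) : measurable B ->
  pushforward haar (@ln R : measurableTypeR R -> measurableTypeR R) B = leb B.
Proof.
move=> mB; apply/esym/lebesgue_measure_unique => //= _ [[a b]] _ <-.
rewrite /pushforward /haar.
rewrite (_ : _ `&` Rplus = `]expR a, expR b]%classic); last first.
  apply/seteqP; split => x /=; rewrite /Rplus/= !in_itv/= ?andbT.
    by case=> /andP[ax xb] x0; rewrite -(lnK x0) ltr_expR ler_expR ax xb.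
  move=> /andP[ax xb]; have x0 : 0 < x by rewrite (lt_trans _ ax)// expR_gt0.
  by split => //; rewrite -ltr_expR -ler_expR lnK ?posrE// ax xb.
rewrite lebesgue_measure_itv/= lte_fin; case: ifPn => ab; last first.
  by rewrite set_itv_ge ?integral_set0// bnd_simp ltr_expR.
have ab' : expR a < expR b by rewrite ltr_expR.
have x0 (x : R) : x \in `[expR a, expR b] -> 0 < x.
  by rewrite in_itv/= => /andP[ax _]; rewrite (lt_le_trans _ ax)// expR_gt0.
have cV : {within `[expR a, expR b], continuous (fun r : R => r^-1)}.
  apply: continuous_in_subspaceT => x /set_mem /x0 x_gt0.
  by apply: inv_continuous; rewrite gt_eqF.
have iV : leb.-integrable `[expR a, expR b] (EFin \o (fun r : R => r^-1)).
  by apply: continuous_compact_integrable => //; exact: segment_compact.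
rewrite integral_itv_obnd_cbnd; last first.
  apply: measurable_funS (measurable_int _ iV) => //.
  by apply: subset_itvr; rewrite bnd_simp.
rewrite (@continuous_FTC2 _ _ (@ln R))//.
- by rewrite !expRK.
- split.
  + move=> x; rewrite in_itv/= => /andP[ax xb].
    have x_gt0 : 0 < x by rewrite (lt_trans _ ax)// expR_gt0.
    by case: (is_derive1_ln x_gt0).
  + by apply: cvg_at_right_filter; apply: continuous_ln; exact: expR_gt0.
  + by apply: cvg_at_left_filter; apply: continuous_ln; exact: expR_gt0.
- move=> x; rewrite in_itv/= => /andP[ax xb].
  have x_gt0 : 0 < x by rewrite (lt_trans _ ax)// expR_gt0.
  by have dx := is_derive1_ln x_gt0; rewrite derive1E derive_val.
Qed.

Lemma haar_expR (A : set (measurableTypeR R)) : measurable A ->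
  haar A = pushforward leb (@expR R : measurableTypeR R -> measurableTypeR R) A.
Proof.
move=> mA; rewrite /pushforward -lebesgue_haar; last first.
  by rewrite -[X in measurable X]setTI; exact: measurable_expR.
rewrite /pushforward -haar_setIRplus -[RHS]haar_setIRplus; congr haar.
apply/seteqP; split => x /= [Ax x0]; split => //;
  move: (x0); rewrite /Rplus/= in_itv/= andbT => x0';
  by move: Ax; rewrite lnK.
Qed.

Lemma haar_integral (phi : R -> \bar R) : measurable_fun Rplus phi ->
  (forall r, Rplus r -> 0 <= phi r)%E ->
  (\int[haar]_(r in Rplus) phi r = \int[leb]_x phi (expR x))%E.
Proof.
move=> mphi phi0.
rewrite (@eq_measure_integral _ _ _ _
  (pushforward leb (@expR R : measurableTypeR R -> measurableTypeR R))); last first.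
  by move=> A mA _; exact: haar_expR.
rewrite ge0_integral_pushforward//=.
- rewrite (_ : expR @^-1` Rplus = setT)//.
  by apply/seteqP; split => x // _; exact: Rplus_expR.
- exact: measurable_Rplus.
- by move=> y /set_mem; exact: phi0.
Qed.

End haar_transport.

(** * Bessel's inequality for orthonormal and Riesz sequences *)

Section bessel.
Context d (T : measurableType d) (R : realType).
Variables (mu : {measure set T -> \bar R}) (D : set T) (mD : measurable D).
Local Notation sqi := (square_integrable mu D).
Local Notation energy := (real_energy mu D).
Implicit Types (p : nat -> T -> R) (c : nat -> R).

Definition real_lincomb c p N : T -> R := fun x => \sum_(i < N) c i * p i x.

Lemma real_lincombS c p N :
  real_lincomb c p N.+1 = (fun x => real_lincomb c p N x + c N * p N x).
Proof. by apply/funext => x; rewrite /real_lincomb big_ord_recr. Qed.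

Lemma sqi_real_lincomb c p N : (forall n, sqi (p n)) -> sqi (real_lincomb c p N).
Proof.
move=> sp; elim: N => [|N IH]; last first.
  by rewrite real_lincombS; apply: sqiD => //; exact: sqiZ.
have -> : real_lincomb c p 0 = (fun x => 0 * p 0 x).
  by apply/funext => x; rewrite /real_lincomb big_ord0 mul0r.
exact: sqiZ.
Qed.

Lemma Rint_real_lincomb c p N phi : (forall n, sqi (p n)) -> sqi phi ->
  \int[mu]_(x in D) (real_lincomb c p N x * phi x) =
  \sum_(i < N) c i * \int[mu]_(x in D) (p i x * phi x).
Proof.
move=> sp sphi; elim: N => [|N IH].
  rewrite big_ord0 (@eq_Rintegral _ _ _ mu D (cst 0)).
    by rewrite Rintegral_cst// mul0r.
  by move=> x _; rewrite /real_lincomb big_ord0 mul0r.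
rewrite big_ord_recr /= -IH -RintegralZl//; last exact: sqi_mul.
rewrite -RintegralD//.
- by apply: eq_Rintegral => x _; rewrite real_lincombS; ring.
- by apply: sqi_mul => //; exact: sqi_real_lincomb.
- by apply: intgZ => //; exact: sqi_mul.
Qed.

Variables (p : nat -> T -> R) (K : R).
Hypotheses (sp : forall n, sqi (p n)) (K0 : 0 < K).
Hypothesis pK : forall c N, energy (real_lincomb c p N) <= K * \sum_(i < N) c i ^+ 2.

(** Duality: with the pairings [r i] of [p i] and [phi] as coefficients, expand
the nonnegative energy of [sum_i r i * p i - K * phi]. *)
Lemma bessel phi N : sqi phi ->
  \sum_(i < N) (\int[mu]_(x in D) (p i x * phi x)) ^+ 2 <= K * energy phi.
Proof.
move=> sphi; pose r i := \int[mu]_(x in D) (p i x * phi x).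
have sr := sqi_real_lincomb r N sp.
have := energy_ge0 mu D (fun x => real_lincomb r p N x + - K * phi x).
rewrite energyD//; last exact: sqiZ.
rewrite energyZ//.
have -> : \int[mu]_(x in D) (real_lincomb r p N x * (- K * phi x)) = - K * \sum_(i < N) r i ^+ 2.
  under eq_bigr do rewrite expr2.
  rewrite -Rint_real_lincomb// -RintegralZl//; last exact: sqi_mul.
  by apply: eq_Rintegral => x _; ring.
have := pK r N; rewrite -/(r _).
move: (\sum_(i < N) r i ^+ 2) (energy phi) (energy (real_lincomb r p N)) => S e E.
move=> H1 H2.
have H3 : 0 <= K * (K * e - S) by nra.
by move: H3; rewrite pmulr_rge0// subr_ge0.
Qed.

Lemma bessel1 phi n : sqi phi ->
  (\int[mu]_(x in D) (p n x * phi x)) ^+ 2 <= K * energy phi.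
Proof.
move=> sphi; apply: le_trans (bessel n.+1 sphi).
by rewrite big_ord_recr /= lerDr sumr_ge0// => i _; exact: sqr_ge0.
Qed.

Lemma weak_null phi : sqi phi ->
  (\int[mu]_(x in D) (p n x * phi x)) ^+ 2 @[n --> \oo] --> (0 : R).
Proof.
move=> sphi; apply: cvg_series_cvg_0; apply: nondecreasing_is_cvgn.
  apply: nondecreasing_series => n _ _; exact: sqr_ge0.
exists (K * energy phi) => _ [N _ <-].
by rewrite /series /= big_mkord; exact: bessel.
Qed.

End bessel.

Section riesz.
Context d (T : measurableType d) (R : realType).
Variables (mu : {measure set T -> \bar R}) (D : set T) (mD : measurable D).
Implicit Types (u : nat -> T -> R[i]) (c : nat -> R) (f g : T -> R[i]).
Local Notation intg := (real_integrable mu D).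
Local Notation sqi := (square_integrable mu D).
Local Notation csqi := (complex_square_integrable mu D).
Local Notation cenergy := (complex_energy mu D).

Definition lincomb c u N : T -> R[i] := fun x => \sum_(i < N) ((c i)%:C%C * u i x).

Lemma lincombS c u N : lincomb c u N.+1 = (fun x => (c N)%:C%C * u N x + lincomb c u N x).
Proof. by apply/funext => x; rewrite /lincomb big_ord_recr addrC. Qed.

Lemma lincomb0 c u : lincomb c u 0 = (fun=> 0).
Proof. by apply/funext => x; rewrite /lincomb big_ord0. Qed.

Lemma csqi0 : csqi (fun=> 0).
Proof.
have s0 : sqi (fun=> 0).
  by split => //; apply: (@eq_intg _ _ _ mu D mD (cst 0)) => [x _|];
    [rewrite expr0n|exact: integrable0].
by split.
Qed.

Lemma csqi_lincomb c u N : (forall n, csqi (u n)) -> csqi (lincomb c u N).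
Proof.
move=> su; elim: N => [|N IH]; first by rewrite lincomb0; exact: csqi0.
by rewrite lincombS; apply: csqiD => //; exact: csqiZ.
Qed.

Lemma Re_lincomb c u N x :
  complex.Re (lincomb c u N x) = real_lincomb c (fun n x => complex.Re (u n x)) N x.
Proof.
elim: N => [|N IH]; first by rewrite /lincomb /real_lincomb !big_ord0.
rewrite lincombS real_lincombS -IH; case: (u N x) (lincomb c u N x) => ? ? [? ?] /=; ring.
Qed.

Lemma Im_lincomb c u N x :
  complex.Im (lincomb c u N x) = real_lincomb c (fun n x => complex.Im (u n x)) N x.
Proof.
elim: N => [|N IH]; first by rewrite /lincomb /real_lincomb !big_ord0.
rewrite lincombS real_lincombS -IH; case: (u N x) (lincomb c u N x) => ? ? [? ?] /=; ring.
Qed.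

Definition reinner f g : R :=
  \int[mu]_(x in D) (complex.Re (f x) * complex.Re (g x) + complex.Im (f x) * complex.Im (g x)).

Lemma Re_inner f g : complex.Re (inner mu D f g) = reinner f g.
Proof. by apply: eq_Rintegral => x _; case: (f x) (g x) => ? ? [? ?] /=; ring. Qed.

Lemma intg_reinner f g : csqi f -> csqi g ->
  intg (fun x => complex.Re (f x) * complex.Re (g x) + complex.Im (f x) * complex.Im (g x)).
Proof. by move=> [fr fi] [gr gi]; apply: intgD => //; exact: sqi_mul. Qed.

Lemma reinner_self f : csqi f -> cenergy f = reinner f f.
Proof. by move=> sf; rewrite cenergyE//; apply: eq_Rintegral => x _; rewrite !expr2. Qed.

Lemma reinnerC f g : reinner f g = reinner g f.
Proof. by apply: eq_Rintegral => x _; ring. Qed.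

Lemma reinnerDZ (c : R) f g h : csqi f -> csqi g -> csqi h ->
  reinner (fun x => c%:C%C * f x + g x) h = c * reinner f h + reinner g h.
Proof.
move=> sf sg sh; rewrite /reinner -RintegralZl//; last exact: intg_reinner.
rewrite -RintegralD//; [|apply: intgZ => //; exact: intg_reinner|exact: intg_reinner].
by apply: eq_Rintegral => x _; case: (f x) (g x) (h x) => ? ? [? ?] [? ?] /=; ring.
Qed.

Lemma reinner_lincomb u c N h : (forall n, csqi (u n)) -> csqi h ->
  reinner (lincomb c u N) h = \sum_(i < N) c i * reinner (u i) h.
Proof.
move=> su sh; elim: N => [|N IH].
  rewrite lincomb0 big_ord0 /reinner (@eq_Rintegral _ _ _ mu D (cst 0)).
    by rewrite Rintegral_cst// mul0r.
  by move=> x _; rewrite /= !mul0r addr0.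
rewrite lincombS reinnerDZ//; last exact: csqi_lincomb.
by rewrite IH big_ord_recr addrC.
Qed.

Lemma orthonormal_lincomb u c N : orthonormal_sequence mu D u ->
  cenergy (lincomb c u N) = \sum_(i < N) c i ^+ 2.
Proof.
move=> [Lu ou]; have su n : csqi (u n) by exact: L2_csqi.
have ru n m : reinner (u n) (u m) = (n == m)%:R.
  by rewrite -Re_inner ou; case: (n == m).
have sc := csqi_lincomb c N su.
rewrite reinner_self// reinner_lincomb//; apply: eq_bigr => i _.
rewrite reinnerC reinner_lincomb// (bigD1 i)//= ru eqxx mulr1 big1 ?addr0 ?expr2//.
by move=> j ji; rewrite ru (negbTE (ji : (j : nat) != i)) mulr0.
Qed.

Lemma bounded_operator_cenergy U : bounded_operator mu D U ->
  exists K : R, 0 <= K /\ forall f, csqi f -> cenergy (U f) <= K * cenergy f.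
Proof.
move=> [UL2 _ _ [K UK]]; exists (K ^+ 2); split; first exact: sqr_ge0.
move=> f sf; have Lf := csqi_L2 mD sf.
have sUf := L2_csqi mD (UL2 _ Lf).
have := UK _ Lf; rewrite !L2norm_cenergy// -EFinM lee_fin => H.
have : Num.sqrt (cenergy (U f)) ^+ 2 <= (K * Num.sqrt (cenergy f)) ^+ 2.
  by rewrite lerXn2r ?nnegrE ?sqrtr_ge0// (le_trans _ H)// sqrtr_ge0.
by rewrite exprMn !sqr_sqrtr// cenergy_ge0.
Qed.

(** The common features of orthonormal and Riesz sequences on which the theorem
rests.  Real coefficients suffice, since real and imaginary parts are paired
with real test functions; one constant serves for the upper bound and, through
its inverse, for the lower bound on the energies. *)
Definition bessel_sequence (K : R) u := [/\ 0 < K, forall n, csqi (u n),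
  forall c N, cenergy (lincomb c u N) <= K * \sum_(i < N) c i ^+ 2 &
  forall n, 1 <= K * cenergy (u n)].

Lemma orthonormal_bessel u : orthonormal_sequence mu D u -> bessel_sequence 1 u.
Proof.
move=> ou; have [Lu iu] := ou; have su n : csqi (u n) by exact: L2_csqi.
split => //.
- by move=> c N; rewrite orthonormal_lincomb// mul1r.
- by move=> n; rewrite mul1r reinner_self// -Re_inner iu eqxx.
Qed.

(** The inverse [V] maps [sum_i c i * U (u i)] back to [sum_i c i * u i], so
boundedness of [V] bounds the combinations of [u]; boundedness of [U] bounds
the energies of the [u n] from below. *)
Lemma riesz_bessel u : riesz_sequence mu D u -> exists K, bessel_sequence K u.
Proof.
move=> [Lu [U [V [bU bV VU _ oU]]]].
have su n : csqi (u n) by exact: L2_csqi.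
have [K1 [K10 UK]] := bounded_operator_cenergy bU.
have [K2 [K20 VK]] := bounded_operator_cenergy bV.
have [eL2 eo] := oU; set e := fun n => U (u n) in oU eL2 eo.
have se n : csqi (e n) := L2_csqi mD (eL2 n).
exists (K1 + K2 + 1); split => //.
- by lra.
- move=> c N.
  have VE : V (lincomb c e N) = lincomb c u N %[ae mu in D].
    elim: N => [|N IH].
      (* linearity at zero gives [V 0 = V 0 + V 0] *)
      have L0 := csqi_L2 mD csqi0.
      have := op_linear bV 1 L0 L0; rewrite !lincomb0.
      under [X in V X]eq_fun do rewrite mulr0 addr0.
      apply: filterS => x H Dx; move: (H Dx); rewrite mul1r.
      by move=> /eqP; rewrite -subr_eq subrr => /eqP <-.
    have := op_linear bV (c N)%:C%C (eL2 N) (csqi_L2 mD (csqi_lincomb c N se)).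
    rewrite !lincombS; apply: filterS3 IH (VU _ (Lu N)) => x H1 H2 H3 Dx.
    by rewrite H3// H1// H2.
  have sc := csqi_lincomb c N su.
  have sVc := L2_csqi mD (op_L2 bV (csqi_L2 mD (csqi_lincomb c N se))).
  rewrite -(cenergy_ae mD sVc sc VE).
  apply: (le_trans (VK _ (csqi_lincomb c N se))).
  rewrite orthonormal_lincomb// ler_wpM2r ?sumr_ge0//; last by lra.
  by move=> i _; exact: sqr_ge0.
- move=> n; have := UK _ (su n).
  rewrite [cenergy (U _)]reinner_self; last exact: se.
  rewrite -Re_inner eo eqxx => /le_trans; apply.
  by rewrite ler_wpM2r ?cenergy_ge0//; lra.
Qed.

End riesz.

(** * Restriction to a bounded window *)

Section cutoff.
Context {R : realType}.
Local Notation leb := (@lebesgue_measure R).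
Local Notation sqi := (square_integrable leb setT).
Local Notation csqi := (complex_square_integrable leb setT).
Local Notation cintg := (cintegrable leb setT).
Local Notation cenergy := (complex_energy leb setT).
Implicit Types f g h u v : R -> R[i].

Definition cutoff (L : R) f : R -> R[i] := fun x => if `|x| <= L then f x else 0.

Lemma Re_cutoff L f : (fun x => complex.Re (cutoff L f x)) =
  (fun x => if `|x| <= L then complex.Re (f x) else 0).
Proof. by apply/funext => x; rewrite /cutoff; case: ifP. Qed.

Lemma Im_cutoff L f : (fun x => complex.Im (cutoff L f x)) =
  (fun x => if `|x| <= L then complex.Im (f x) else 0).
Proof. by apply/funext => x; rewrite /cutoff; case: ifP. Qed.

Lemma sqi_cut_restrict (L : R) (p : R -> R) : sqi p ->
  sqi (fun x => if `|x| <= L then p x else 0).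
Proof.
move=> sp; have m : measurable_fun setT (fun x : R => if `|x| <= L then p x else 0).
  by apply: measurable_cut; exact: sp.1.
split => //; apply: (le_intg measurableT _ sp.2); first exact: measurable_funX.
by move=> x _; rewrite ger0_norm ?sqr_ge0//; case: ifP => // _; rewrite expr0n sqr_ge0.
Qed.

Lemma csqi_cutoff L f : csqi f -> csqi (cutoff L f).
Proof. by move=> [sr si]; split; rewrite ?Re_cutoff ?Im_cutoff; exact: sqi_cut_restrict. Qed.

Lemma cenergy_cutoff_le L f : csqi f -> cenergy (cutoff L f) <= cenergy f.
Proof.
move=> sf; have [sr si] := csqi_cutoff L sf.
apply: lerD; apply: le_energy => //; try by [exact: sf.1|exact: sf.2].
  by move=> x _; rewrite /cutoff; case: ifP => //= _; rewrite normr0.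
by move=> x _; rewrite /cutoff; case: ifP => //= _; rewrite normr0.
Qed.

Lemma cutoffB L f g : (fun x => cutoff L f x - cutoff L g x) = cutoff L (fun x => f x - g x).
Proof. by apply/funext => x; rewrite /cutoff; case: ifP => // _; rewrite subrr. Qed.

(** On a bounded window a square-integrable function is integrable, by pairing it
with the indicator of the window. *)
Lemma cintg_cutoff L f : csqi f -> cintg (cutoff L f).
Proof.
move=> [sr si].
have s1 : sqi (fun x : R => if `|x| <= L then 1 else 0).
  by apply: (sqi_cut (C := 1)) => // x _; rewrite normr1.
split.
  apply: (eq_intg measurableT _ (sqi_mul measurableT sr s1)) => x _.
  by rewrite /cutoff; case: ifP => _; rewrite ?mulr1 ?mulr0.
apply: (eq_intg measurableT _ (sqi_mul measurableT si s1)) => x _.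
by rewrite /cutoff; case: ifP => _; rewrite ?mulr1 ?mulr0.
Qed.

Lemma integral_tail (psi : R -> \bar R) (e : R) : measurable_fun setT psi ->
  (forall x, 0 <= psi x)%E -> (\int[leb]_x psi x < +oo)%E -> 0 < e ->
  exists L : R, (\int[leb]_x (if (`|x| <= L)%R then 0 else psi x) <= e%:E)%E.
Proof.
move=> mpsi psi0 psioo e0.
have mt (L : R) : measurable_fun setT (fun x : R => if `|x| <= L then 0%E else psi x).
  apply: measurable_fun_ifT => //.
  by apply: measurable_fun_ler => //; exact: measurableT_comp.
have [|||||_ _] := @dominated_convergence _ _ _ leb setT measurableT
  (fun n x => if `|x| <= n%:R then 0%E else psi x) (cst 0%E) psi.
- by move=> n; exact: mt.
- exact: measurable_cst.
- apply: aeW => x _; apply: cvg_near_cst; near=> n; rewrite ifT//.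
  by near: n; exact: nbhs_infty_ger.
- by apply/integrableP; split => //; under eq_integral do rewrite gee0_abs//.
- by apply: aeW => x n _; case: ifP => _; rewrite ?abse0// gee0_abs.
rewrite integral0 => /fine_cvgP[fin_n /cvgrPdist_le /(_ e e0) cn].
have [n [n1 n2]] : exists n,
   ((\int[leb]_x (if (`|x| <= n%:R)%R then 0 else psi x))%E \is a fin_num) /\
   `|0 - fine (\int[leb]_x (if (`|x| <= n%:R)%R then 0 else psi x))%E| <= e.
  by near \oo => n; exists n; split; near: n.
exists n%:R; rewrite -(fineK n1) lee_fin; move: n2; rewrite sub0r normrN.
exact: le_trans (ler_norm _).
Unshelve. all: end_near. Qed.

Lemma cenergy_tail L f (psi : R -> \bar R) (e : R) : csqi f -> measurable_fun setT psi ->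
  (forall x, 0 <= psi x)%E ->
  (forall x, (complex.Re (f x) ^+ 2 + complex.Im (f x) ^+ 2)%:E <= psi x)%E ->
  (\int[leb]_x (if (`|x| <= L)%R then 0 else psi x) <= e%:E)%E ->
  cenergy (fun x => f x - cutoff L f x) <= e.
Proof.
move=> sf mpsi psi0 fpsi; rewrite -lee_fin; apply: le_trans.
have sd := csqiB measurableT sf (csqi_cutoff L sf).
rewrite EFin_cenergy//; apply: ge0_le_integral => //.
- by move=> x _; rewrite lee_fin addr_ge0 ?sqr_ge0.
- by apply/measurable_EFinP; exact: intg_measurable (csqi_intg measurableT sd).
- apply: measurable_fun_ifT => //.
  by apply: measurable_fun_ler => //; exact: measurableT_comp.
- move=> x _; rewrite /cutoff; case: ifP => _; last by rewrite subr0.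
  by rewrite subrr /= expr0n addr0.
Qed.

Lemma eL2_sqr d (T : measurableType d) (mu : {measure set T -> \bar R}) (D : set T)
    (h : T -> \bar R) : measurable D -> (forall x, D x -> 0 <= h x)%E -> eL2 mu D h ->
  measurable_fun D (fun x => h x `^ 2)%E /\ (\int[mu]_(x in D) (h x `^ 2) < +oo)%E.
Proof.
move=> mD h0 [mh hoo]; split.
  exact: (measurableT_comp (measurable_poweR _)).
by rewrite -L2norm_sqr// poweR_lty.
Qed.

End cutoff.

(** * Transforms of restricted functions on a bounded frequency window *)

Section local_transforms.
Context {R : realType}.
Local Notation leb := (@lebesgue_measure R).
Local Notation sqi := (square_integrable leb setT).
Local Notation energy := (real_energy leb setT).
Local Notation csqi := (complex_square_integrable leb setT).
Local Notation cintg := (cintegrable leb setT).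
Local Notation cenergy := (complex_energy leb setT).

Let trig_cut (t : R -> R) (L b x : R) : R := if `|x| <= L then t (b * x) else 0.

(** The transform of a restricted function pairs the function itself with a
truncated sine or cosine, to which Bessel's inequality applies. *)
Let trig_null (t : R -> R) (p : nat -> R -> R) (K L b : R) :
  measurable_fun setT t -> (forall x, `|t x| <= 1) ->
  (forall n, sqi (p n)) -> 0 < K ->
  (forall c N, energy (real_lincomb c p N) <= K * \sum_(i < N) c i ^+ 2) ->
  (\int[leb]_x ((if `|x| <= L then p n x else 0) * t (b * x))) ^+ 2 @[n --> \oo] --> (0 : R) /\
  forall n, (\int[leb]_x ((if `|x| <= L then p n x else 0) * t (b * x))) ^+ 2 <=
    K * energy (fun x : R => if `|x| <= L then 1 else 0).
Proof.
move=> mt t1 sp K0 pK.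
have E n : \int[leb]_x ((if `|x| <= L then p n x else 0) * t (b * x)) =
    \int[leb]_x (p n x * trig_cut t L b x).
  by apply: eq_Rintegral => x _; rewrite /trig_cut; case: ifP => _; rewrite ?mul0r ?mulr0.
have st : sqi (trig_cut t L b).
  apply: (sqi_cut (g := fun x => t (b * x)) (C := 1)) => //.
  by apply: (measurableT_comp mt); exact: measurable_funM.
have s1 : sqi (fun x : R => if `|x| <= L then 1 else 0).
  by apply: (sqi_cut (C := 1)) => // x _; rewrite normr1.
split.
  under eq_cvg do rewrite E.
  exact: (weak_null measurableT sp K0 pK st).
move=> n; rewrite E; apply: (le_trans (bessel1 measurableT sp K0 pK n st)).
rewrite ler_wpM2l ?(ltW K0)//; apply: le_energy => // x _.
by rewrite /trig_cut; case: ifP => _; rewrite ?normr1 ?normr0.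
Qed.

(** The squared modulus of the transform tends to zero pointwise, and Bessel's
inequality bounds it by a constant; on a bounded window this is enough for
dominated convergence. *)
Lemma fourier_cutoff_null (f : nat -> R -> R[i]) (K L M : R) :
  bessel_sequence leb setT K f ->
  cenergy (cutoff M (fourier (cutoff L (f n)))) @[n --> \oo] --> (0 : R).
Proof.
move=> [K0 sf fK _].
pose p n x := complex.Re (f n x); pose q n x := complex.Im (f n x).
have sp n : sqi (p n) := (sf n).1; have sq n : sqi (q n) := (sf n).2.
have pK c N : energy (real_lincomb c p N) <= K * \sum_(i < N) c i ^+ 2.
  apply: le_trans (fK c N).
  rewrite (_ : real_lincomb c p N = fun x => complex.Re (lincomb c f N x)).
    by rewrite lerDl energy_ge0.
  by apply/funext => x; rewrite Re_lincomb.
have qK c N : energy (real_lincomb c q N) <= K * \sum_(i < N) c i ^+ 2.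
  apply: le_trans (fK c N).
  rewrite (_ : real_lincomb c q N = fun x => complex.Im (lincomb c f N x)).
    by rewrite lerDr energy_ge0.
  by apply/funext => x; rewrite Im_lincomb.
have mcos : measurable_fun setT (@cos R) := continuous_measurable_fun (@continuous_cos R).
have msin : measurable_fun setT (@sin R) := continuous_measurable_fun (@continuous_sin R).
pose v n := cutoff L (f n).
have iv n : cintg (v n) := cintg_cutoff L (sf n).
have sv n : csqi (v n) := csqi_cutoff L (sf n).
have sV n : csqi (fourier (v n)) := (plancherel (iv n) (sv n)).1.
pose a n w := cos_transform (fun x => complex.Re (v n x)) w.
pose b n w := sin_transform (fun x => complex.Im (v n x)) w.
pose c n w := cos_transform (fun x => complex.Im (v n x)) w.
pose e n w := sin_transform (fun x => complex.Re (v n x)) w.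
pose C := K * energy (fun x : R => if `|x| <= L then 1 else 0).
have aP w : a n w ^+ 2 @[n --> \oo] --> (0 : R) /\ forall n, a n w ^+ 2 <= C.
  have [H1 H2] := trig_null L (2 * pi * w) mcos (@cos_max R) sp K0 pK.
  have E n : a n w = \int[leb]_x ((if `|x| <= L then p n x else 0) * cos (2 * pi * w * x)).
    by rewrite /a /v Re_cutoff.
  by split => [|n]; [under eq_cvg do rewrite E; exact: H1|rewrite E; exact: H2].
have bP w : b n w ^+ 2 @[n --> \oo] --> (0 : R) /\ forall n, b n w ^+ 2 <= C.
  have [H1 H2] := trig_null L (2 * pi * w) msin (@sin_max R) sq K0 qK.
  have E n : b n w = \int[leb]_x ((if `|x| <= L then q n x else 0) * sin (2 * pi * w * x)).
    by rewrite /b /v Im_cutoff.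
  by split => [|n]; [under eq_cvg do rewrite E; exact: H1|rewrite E; exact: H2].
have cP w : c n w ^+ 2 @[n --> \oo] --> (0 : R) /\ forall n, c n w ^+ 2 <= C.
  have [H1 H2] := trig_null L (2 * pi * w) mcos (@cos_max R) sq K0 qK.
  have E n : c n w = \int[leb]_x ((if `|x| <= L then q n x else 0) * cos (2 * pi * w * x)).
    by rewrite /c /v Im_cutoff.
  by split => [|n]; [under eq_cvg do rewrite E; exact: H1|rewrite E; exact: H2].
have eP w : e n w ^+ 2 @[n --> \oo] --> (0 : R) /\ forall n, e n w ^+ 2 <= C.
  have [H1 H2] := trig_null L (2 * pi * w) msin (@sin_max R) sp K0 pK.
  have E n : e n w = \int[leb]_x ((if `|x| <= L then p n x else 0) * sin (2 * pi * w * x)).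
    by rewrite /e /v Re_cutoff.
  by split => [|n]; [under eq_cvg do rewrite E; exact: H1|rewrite E; exact: H2].
pose B n w := 2 * (a n w ^+ 2 + b n w ^+ 2 + (c n w ^+ 2 + e n w ^+ 2)).
pose Q n w := complex.Re (fourier (v n) w) ^+ 2 + complex.Im (fourier (v n) w) ^+ 2.
have Q0 n w : 0 <= Q n w by rewrite addr_ge0 ?sqr_ge0.
have QB n w : Q n w <= B n w.
  rewrite /Q fourierE//= -/(a n w) -/(b n w) -/(c n w) -/(e n w) /B.
  move: (a n w) (b n w) (c n w) (e n w) => x y z t.
  by have := sqr_ge0 (x - y); have := sqr_ge0 (z + t); nra.
have BC n w : B n w <= 8 * C.
  rewrite (_ : 8 * C = 2 * (C + C + (C + C))); last by ring.
  rewrite ler_wpM2l//; apply: lerD; apply: lerD.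
  - exact: (aP w).2.
  - exact: (bP w).2.
  - exact: (cP w).2.
  - exact: (eP w).2.
have Bcvg w : B n w @[n --> \oo] --> (0 : R).
  rewrite (_ : 0 = 2 * (0 + 0 + (0 + 0)) :> R); last by rewrite !addr0 mulr0.
  apply: cvgM; first exact: cvg_cst.
  apply: cvgD; apply: cvgD.
  - exact: (aP w).1.
  - exact: (bP w).1.
  - exact: (cP w).1.
  - exact: (eP w).1.
have mQ n : measurable_fun setT (Q n) := intg_measurable (csqi_intg measurableT (sV n)).
have EQ n : cenergy (cutoff M (fourier (v n))) = \int[leb]_w (if `|w| <= M then Q n w else 0).
  rewrite cenergyE//; last exact: csqi_cutoff.
  apply: eq_Rintegral => w _; rewrite /cutoff /Q; case: ifP => //= _.
  by rewrite expr0n addr0.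
under eq_cvg do rewrite EQ.
have z0 : \int[leb]_x (cst 0 x : R) = 0 by rewrite Rintegral_cst// mul0r.
suff : \int[leb]_w (if `|w| <= M then Q n w else 0) @[n --> \oo] --> \int[leb]_x (cst 0 x : R).
  by rewrite z0.
apply: (@Rint_dominated _ _ _ leb setT measurableT
  (fun n w => if `|w| <= M then Q n w else 0) (cst 0)
  (fun w => if `|w| <= M then 8 * C else 0)).
- by move=> n; exact: measurable_cut.
- exact: measurable_cst.
- exact: intg_cut_cst.
- move=> n w _; case: ifP => _; last by rewrite normr0.
  by rewrite ger0_norm// (le_trans (QB n w)).
- apply: aeW => w _; case: (`|w| <= M); last exact: cvg_cst.
  apply: (@squeeze_cvgr _ _ _ _ (cst 0) (fun n => B n w)) => //; last exact: cvg_cst.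
  by apply: nearW => n /=; rewrite Q0 QB.
Qed.

End local_transforms.

(** * Domination on both sides is impossible *)

Section transport.
Context {R : realType}.
Local Notation leb := (@lebesgue_measure R).

Lemma measurable_fun_expR (phi : R -> \bar R) : measurable_fun Rplus phi ->
  measurable_fun setT (fun x => phi (expR x)).
Proof.
move=> mphi; apply: (measurable_comp (F := Rplus)) => //.
- exact: measurable_Rplus.
- by move=> _ [x _ <-]; exact: Rplus_expR.
Qed.

Lemma cenergy_expR (f : R -> R[i]) : complex_square_integrable haar Rplus f ->
  complex_square_integrable leb setT (fun x => f (expR x)) ->
  complex_energy leb setT (fun x => f (expR x)) = complex_energy haar Rplus f.
Proof.
move=> sf sfe; apply: EFin_inj; rewrite !EFin_cenergy//; last exact: measurable_Rplus.
rewrite haar_integral//.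
- apply/measurable_EFinP.
  exact: (intg_measurable (csqi_intg measurable_Rplus sf)).
- by move=> r _; rewrite lee_fin addr_ge0 ?sqr_ge0.
Qed.

Lemma bessel_sequence_expR (K : R) (g : nat -> R -> R[i]) :
  bessel_sequence haar Rplus K g ->
  (forall n, complex_square_integrable leb setT (fun x => g n (expR x))) ->
  bessel_sequence leb setT K (fun n x => g n (expR x)).
Proof.
move=> [K0 sg gK gK1] sf; split => //.
- move=> c N; apply: le_trans (gK c N).
  rewrite -(@cenergy_expR (lincomb c g N))//.
    by apply: csqi_lincomb => //; exact: measurable_Rplus.
  exact: (csqi_lincomb measurableT c N sf).
- by move=> n; rewrite cenergy_expR.
Qed.

Lemma modulus_sqr (d : measure_display) (T : measurableType d) (f : T -> R[i]) x :
  (modulus f x `^ 2 = (complex.Re (f x) ^+ 2 + complex.Im (f x) ^+ 2)%:E)%E.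
Proof. by rewrite /modulus poweR_EFin powR_mulrn ?normc_ge0// normc_sqr. Qed.

Lemma sup_modulus_ge (d : measure_display) (T : measurableType d) (f : nat -> T ->
  R[i]) n x :
  (modulus (f n) x <= ereal_sup (range (fun n => modulus (f n) x)))%E.
Proof. by apply: ereal_sup_ubound; exists n. Qed.

Lemma sup_modulus_ge0 (d : measure_display) (T : measurableType d) (f : nat -> T ->
  R[i]) x :
  (0 <= ereal_sup (range (fun n => modulus (f n) x)))%E.
Proof. by apply: le_trans (sup_modulus_ge f 0 x); rewrite lee_fin normc_ge0. Qed.

Lemma sup_modulus_sqr_ge (d : measure_display) (T : measurableType d) (f : nat -> T ->
  R[i]) n x :
  ((complex.Re (f n x) ^+ 2 + complex.Im (f n x) ^+ 2)%:E <=
   ereal_sup (range (fun n => modulus (f n) x)) `^ 2)%E.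
Proof.
rewrite -modulus_sqr; apply: gt0_ler_poweR => //; last exact: sup_modulus_ge.
- by rewrite in_itv/= lee_fin normc_ge0 leey.
- by rewrite in_itv/= sup_modulus_ge0 leey.
Qed.

(** Writing [V] for the energy of the transform of [v n] on the frequency
window, the estimates combine to
[||f n||^2 <= 4 ||h n||^2 <= 4 (2 e + 2 (2 * 4 e + 2 V)) = 72 e + 16 V].
The choice of [e = 1 / (288 K)] and of [n] such that [V < 1 / (64 K)] makes
this less than [1 / (2 K)], while [||f n||^2 >= 1 / K]. *)
Lemma not_both_dominated (K : R) (f h : nat -> R -> R[i]) (psi chi : R -> \bar R) :
  bessel_sequence leb setT K f -> (forall n, is_plancherel (f n) (h n)) ->
  measurable_fun setT psi -> (forall x, 0 <= psi x)%E -> (\int[leb]_x psi x < +oo)%E ->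
  (forall n x, (complex.Re (f n x) ^+ 2 + complex.Im (f n x) ^+ 2)%:E <= psi x)%E ->
  measurable_fun setT chi -> (forall x, 0 <= chi x)%E -> (\int[leb]_x chi x < +oo)%E ->
  (forall n x, (complex.Re (h n x) ^+ 2 + complex.Im (h n x) ^+ 2)%:E <= chi x)%E ->
  False.
Proof.
move=> bf fh mpsi psi0 psioo fpsi mchi chi0 chioo hchi.
have [K0 sf _ fK1] := bf.
have sh n : complex_square_integrable leb setT (h n) by have [_ /(L2_csqi measurableT)] := fh n.
pose e : R := (288 * K)^-1.
have e0 : 0 < e by rewrite /e invr_gt0; exact: mulr_gt0 (ltr0Sn _ _) K0.
have [L psiL] := integral_tail mpsi psi0 psioo e0.
have [M chiM] := integral_tail mchi chi0 chioo e0.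
have v0 := fourier_cutoff_null L M bf.
have c0 : 0 < (64 * K)^-1 by rewrite invr_gt0; exact: mulr_gt0 (ltr0Sn _ _) K0.
move/cvgrPdist_lt : v0 => /(_ _ c0) [n _ /(_ n (leqnn n))].
rewrite sub0r normrN ger0_norm ?cenergy_ge0//.
set v := cutoff L (f n).
have iv : cintegrable leb setT v := cintg_cutoff L (sf n).
have sv : complex_square_integrable leb setT v := csqi_cutoff L (sf n).
have [sV _] := plancherel iv sv.
have fv : complex_energy leb setT (fun x => f n x - v x) <= e.
  exact: cenergy_tail (sf n) mpsi psi0 (fpsi n) psiL.
have hV := is_plancherel_dist (fh n) iv sv.
have fh4 := is_plancherel_le (fh n).
have hM : complex_energy leb setT (fun x => h n x - cutoff M (h n) x) <= e.
  exact: cenergy_tail (sh n) mchi chi0 (hchi n) chiM.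
have h1 := cenergy_le_dist measurableT (sh n) (csqi_cutoff M (sh n)).
have h2 := cenergy_le_dist measurableT (csqi_cutoff M (sh n)) (csqi_cutoff M sV).
rewrite cutoffB in h2.
have h3 := cenergy_cutoff_le M (csqiB measurableT (sh n) sV).
have fn1 := fK1 n.
have eK : K * e = 288^-1 by rewrite /e invfM mulrCA mulfV ?mulr1// gt_eqF.
have eK' : K * (64 * K)^-1 = 64^-1 by rewrite invfM mulrCA mulfV ?mulr1// gt_eqF.
rewrite -(ltr_pM2l K0) eK' => Vn.
have Fle : complex_energy leb setT (f n) <=
    72 * e + 16 * complex_energy leb setT (cutoff M (fourier v)).
  by lra.
have := le_trans fn1 (ler_wpM2l (ltW K0) Fle).
rewrite mulrDr !(mulrCA K) eK; lra.
Qed.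

End transport.

Unset Implicit Arguments.

Theorem corollary4p4 (R : realType) (g Mg : nat -> R -> R[i])
    (hg : orthonormal_sequence haar Rplus g \/ riesz_sequence haar Rplus g)
    (hMg : forall n, is_mellin (g n) (Mg n)) :
  ~ eL2 haar Rplus
      (fun x => ereal_sup (range (fun n => modulus (g n) x))) \/
  ~ eL2 lebesgue_measure setT
      (fun w => ereal_sup (range (fun n => modulus (Mg n) w))).
Proof.
apply/not_andP => -[gsup Mgsup].
have mP := @measurable_Rplus R.
have [K bg] : exists K, bessel_sequence haar Rplus K g.
  case: hg => [og|rg]; first by exists 1; exact: orthonormal_bessel.
  exact: riesz_bessel.
have sf n : complex_square_integrable lebesgue_measure setT (fun x => g n (expR x)).
  by have [/(L2_csqi measurableT)] := hMg n.
have bf := bessel_sequence_expR bg sf.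
have [|mpsi psioo] := eL2_sqr mP _ gsup; first by move=> x _; exact: sup_modulus_ge0.
have [|mchi chioo] := eL2_sqr measurableT _ Mgsup.
  by move=> x _; exact: sup_modulus_ge0.
rewrite haar_integral// in psioo; last by move=> r _; exact: poweR_ge0.
apply: (not_both_dominated bf hMg (measurable_fun_expR mpsi) _ psioo _ mchi _ chioo).
- by move=> x; exact: poweR_ge0.
- by move=> n x; exact: (sup_modulus_sqr_ge g n (expR x)).
- by move=> x; exact: poweR_ge0.
- by move=> n x; exact: (sup_modulus_sqr_ge Mg n x).
Qed.
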